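(* Let $(k_n)_{n\ge0}$ be a strictly increasing sequence of natural numbers with $k_0=0$, and for every $n\ge0$ let $D_n\le\mathrm{Alt}(\{k_n,\dots,k_{n+1}-1\})$ be a (finite) subgroup. Let $G$ be the group of permutations of $\mathbb{Z}$ generated by $\mathrm{Alt}_f(\mathbb{Z})$ and $\prod_{n\ge0}D_n$, with the locally compact group topology for which $\prod_{n\ge0} D_n$, with its product topology, is an open subgroup. Then: (i) $G$ has no non-trivial URS's; (ii) $G$ has no proper (closed) subgroup of finite covolume.
   Context: $\mathrm{Alt}(\Omega)$ is the alternating group on a finite set $\Omega$; $\mathrm{Alt}_f(\mathbb{Z})$ is the group of finitely supported even permutations of $\mathbb{Z}$. The compact group $\prod_{n\ge0}D_n$ is viewed as a permutation group on $\mathbb{Z}$ acting on each interval $\{k_n,\dots,k_{n+1}-1\}$ via $D_n$ and trivially on $\mathbb{Z}_{<0}$. Since every element of $\mathrm{Alt}_f(\mathbb{Z})$ centralizes all but finitely many $D_n$, there is a unique group topology on $G$ for which $\prod_n D_n$ (with the product topology) is an open subgroup; $G$ is then locally compact and second countable. A closed subgroup $H$ of a locally compact group $G$ has finite covolume if $G/H$ carries a $G$-invariant probability measure. $\mathrm{Sub}(G)$ is the compact metrisable space of closed subgroups of $G$ with the Chabauty topology (sub-basis: $\{H: H\cap V\neq\varnothing\}$ for $V$ relatively compact open, $\{H: H\cap C=\varnothing\}$ for $C$ compact), with $G$ acting by conjugation. A URS of $G$ is a minimal non-empty closed conjugation-invariant subset of $\mathrm{Sub}(G)$; $G$ has no non-trivial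 URS's if its only URS's are $\{\{1\}\}$ and $\{G\}$. *)

(* Defs.v *)
From HB Require Import structures.
From mathcomp Require Import all_boot all_order all_algebra all_fingroup.
From mathcomp Require Import all_solvable zify.
From mathcomp Require Import all_classical all_reals all_analysis.

Set Implicit Arguments.
Unset Strict Implicit.
Unset Printing Implicit Defensive.

Import GRing.Theory.

Local Open Scope group_scope.
Local Open Scope classical_set_scope.

(* Locally compact groups, Hausdorff by convention. *)
HB.mixin Record isLCGroup G of monoid.Group G & Topological G := {
  mulg_continuous : continuous (fun xy : G * G => xy.1 * xy.2);
  invg_continuous : continuous (fun x : G => x^-1);
  lcgroup_hausdorff : hausdorff_space G;
  lcgroup_locally_compact : locally_compact [set: G]
}.

#[short(type="lcGroupType")]
HB.structure Definition LCGroup := {G of isLCGroup G & monoid.Group G & Topological G}.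

Definition is_subgroup (G : groupType) (H : set G) : Prop :=
  [/\ H 1, (forall x y, H x -> H y -> H (x * y)) & (forall x, H x -> H x^-1)].

Definition gen_subgroup (G : groupType) (A : set G) : set G :=
  smallest (@is_subgroup G) A.

Lemma gen_subgroupP (G : groupType) (A : set G) : is_subgroup (gen_subgroup A).
Proof.
split=> [B [[]]//|x y Ax Ay B BA|x Ax B BA].
  by case: (BA) => -[_ BM _] _; apply: BM; [exact: Ax | exact: Ay].
by case: (BA) => -[_ _ BV] _; apply: BV; exact: Ax.
Qed.

(* [Sub(G)], the space of closed subgroups of [G]. *)
Record closedSubgroup (G : lcGroupType) := ClosedSubgroup {
  cs_set :> set G;
  cs_subgroup : is_subgroup cs_set;
  cs_closed : closed cs_set
}.

Section closed_subgroups.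
Context {G : lcGroupType}.
Implicit Types (H K : closedSubgroup G) (g : G).

Lemma cs_inj : injective (@cs_set G).
Proof.
move=> [H sH cH] [K sK cK] /= HK; case: K / HK in sK cK *.
by congr ClosedSubgroup; exact: Prop_irrelevance.
Qed.

HB.instance Definition _ := gen_eqMixin (closedSubgroup G).
HB.instance Definition _ := gen_choiceMixin (closedSubgroup G).

(* The Chabauty topology: [(true, V)] indexes the closed subgroups that meet
   [V], and [(false, C)] those that avoid [C]. *)
Definition chabauty_index : set (bool * set G) :=
  [set i | if i.1 then open i.2 /\ precompact i.2 else compact i.2].

Definition chabauty_subbase (i : bool * set G) : set (closedSubgroup G) :=
  [set H | if i.1 then H `&` i.2 !=set0 else H `&` i.2 = set0].

HB.instance Definition _ :=
  isSubBaseTopological.Build (closedSubgroup G) chabauty_index chabauty_subbase.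

Lemma mulgl_continuous g : continuous (fun x : G => g * x).
Proof.
move=> x.
apply: (@continuous_comp _ _ _ (fun x : G => (g, x)) (fun xy => xy.1 * xy.2)).
  by apply: cvg_pair; [exact: cvg_cst | exact: cvg_id].
exact: mulg_continuous.
Qed.

Lemma mulgr_continuous g : continuous (fun x : G => x * g).
Proof.
move=> x.
apply: (@continuous_comp _ _ _ (fun x : G => (x, g)) (fun xy => xy.1 * xy.2)).
  by apply: cvg_pair; [exact: cvg_id | exact: cvg_cst].
exact: mulg_continuous.
Qed.

Lemma cs_conj_set H g :
  [set x ^ g | x in H] = (fun x => x ^ g^-1) @^-1` H.
Proof.
apply/seteqP; split=> [_ [x Hx <-]|x Hx] /=; first by rewrite conjgK.
by exists (x ^ g^-1); rewrite ?conjgKV.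
Qed.

Lemma cs_conj_subgroup H g : is_subgroup [set x ^ g | x in H].
Proof.
have [H1 HM HV] := cs_subgroup H; rewrite cs_conj_set; split=> /=.
- by rewrite conj1g.
- by move=> x y Hx Hy; rewrite conjMg; exact: HM.
- by move=> x Hx; rewrite conjVg; exact: HV.
Qed.

Lemma cs_conj_closed H g : closed [set x ^ g | x in H].
Proof.
have cJ : continuous (fun x : G => x ^ g^-1).
  move=> x.
  apply: (@continuous_comp _ _ _ (fun x : G => x * g^-1)
    (fun y => g^-1^-1 * y)).
    exact: mulgr_continuous.
  exact: mulgl_continuous.
rewrite cs_conj_set; apply: preimage_closed; last exact: cs_closed.
by move=> x _; exact: cJ.
Qed.

Definition cs_conj H g : closedSubgroup G :=
  ClosedSubgroup (cs_conj_subgroup H g) (@cs_conj_closed H g).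

Lemma triv_subgroup : is_subgroup [set 1 : G].
Proof.
by split=> [//|x y -> ->|x ->] /=; rewrite ?mulg1 ?invg1.
Qed.

Lemma full_subgroup : is_subgroup [set: G].
Proof. by []. Qed.

Lemma triv_closed : closed [set 1 : G].
Proof.
by apply: accessible_closed_set1; apply: hausdorff_accessible;
  exact: lcgroup_hausdorff.
Qed.

Definition cs_triv : closedSubgroup G :=
  ClosedSubgroup triv_subgroup triv_closed.

Definition cs_full : closedSubgroup G := ClosedSubgroup full_subgroup closedT.

Definition conj_invariant (X : set (closedSubgroup G)) : Prop :=
  forall H g, X H -> X (cs_conj H g).

Definition URS (X : set (closedSubgroup G)) : Prop :=
  [/\ X !=set0, closed X, conj_invariant X &
      forall Y : set (closedSubgroup G), Y !=set0 -> closed Y ->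
        conj_invariant Y -> Y `<=` X -> Y = X].

Definition no_nontrivial_URS : Prop :=
  forall X : set (closedSubgroup G),
    URS X <-> X = [set cs_triv] \/ X = [set cs_full].

(* The coset space [G/H] of the left cosets [gH]. *)
Definition coset_rel H : rel G := fun x y => `[< cs_set H (x^-1 * y) >].

Lemma coset_relP H : equiv_class_of (coset_rel H).
Proof.
have [H1 HM HV] := cs_subgroup H; split.
- by move=> x; apply/asboolP; rewrite mulVg.
- move=> x y; apply: asbool_equiv_eq; split=> /HV; by rewrite invgM invgK.
- move=> y x z /asboolP xy /asboolP yz; apply/asboolP.
  by have := HM _ _ xy yz; rewrite -mulgA mulKVg.
Qed.

Definition coset_equiv H : equiv_rel G :=
  EquivRelPack (coset_relP H).

Definition coset_space H : Type :=
  quotient_topology {eq_quot (coset_equiv H)}%qT.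

HB.instance Definition _ H := Topological.on (coset_space H).
HB.instance Definition _ H := Quotient.on (coset_space H).
HB.instance Definition _ H :=
  isPointed.Build (coset_space H) (\pi_(coset_space H)%qT (1 : G)).

Definition coset_act H g (c : coset_space H) : coset_space H :=
  (\pi_(coset_space H) (g * generic_quotient.repr c))%qT.

Lemma coset_actE H g x :
  coset_act g (\pi_(coset_space H)%qT x) = \pi_(coset_space H)%qT (g * x).
Proof.
rewrite /coset_act; set r := generic_quotient.repr.body _.
have : \pi_(coset_space H)%qT r = \pi_(coset_space H)%qT x.
  exact: generic_quotient.reprK.
move=> /generic_quotient.eqmodP/asboolP Hrx.
by apply/generic_quotient.eqmodP/asboolP; rewrite invgM -mulgA mulKg.
Qed.

End closed_subgroups.

Arguments no_nontrivial_URS G : clear implicits.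

Definition finite_covolume (R : realType) (G : lcGroupType)
    (H : closedSubgroup G) : Prop :=
  exists P : probability (g_sigma_algebraType (@open (coset_space H))) R,
    forall (g : G) (A : set (coset_space H)),
      (@open (coset_space H)).-sigma.-measurable A ->
      P (coset_act g @^-1` A) = P A.

(* Permutations of [int]; the product is [(s * t) z = t (s z)], as for
   [{perm T}]. *)
Record zperm := ZPerm { zfun :> int -> int; zfun_bij : bijective zfun }.

Lemma zperm_ext (s t : zperm) : s =1 t -> s = t.
Proof.
case: s t => [s sb] [t tb] /= /funext st; case: t / st in tb *.
by congr ZPerm; exact: Prop_irrelevance.
Qed.

HB.instance Definition _ := gen_eqMixin zperm.
HB.instance Definition _ := gen_choiceMixin zperm.

Lemma zperm_inv_subproof (s : zperm) :
  exists t : zperm, cancel s t /\ cancel t s.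
Proof.
case: s => s [t st ts]; have bt : bijective t by exists s.
by exists (ZPerm bt).
Qed.

Definition zperm_one := ZPerm (Bijective (frefl id) (frefl id)).
Definition zperm_inv (s : zperm) := projT1 (cid (zperm_inv_subproof s)).
Definition zperm_mul (s t : zperm) :=
  ZPerm (bij_comp (zfun_bij t) (zfun_bij s)).

Lemma zperm_invP (s : zperm) : cancel s (zperm_inv s) /\ cancel (zperm_inv s) s.
Proof. by rewrite /zperm_inv; case: cid. Qed.

Lemma zperm_mulA : associative zperm_mul.
Proof. by move=> s t u; exact: zperm_ext. Qed.

Lemma zperm_mul1s : left_id zperm_one zperm_mul.
Proof. by move=> s; exact: zperm_ext. Qed.

Lemma zperm_muls1 : right_id zperm_one zperm_mul.
Proof. by move=> s; exact: zperm_ext. Qed.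

Lemma zperm_mulVs : left_inverse zperm_one zperm_inv zperm_mul.
Proof. by move=> s; apply: zperm_ext => z /=; case: (zperm_invP s). Qed.

Lemma zperm_mulsV : right_inverse zperm_one zperm_inv zperm_mul.
Proof. by move=> s; apply: zperm_ext => z /=; case: (zperm_invP s). Qed.

HB.instance Definition _ := isGroup.Build zperm
  zperm_mulA zperm_mul1s zperm_muls1 zperm_mulVs zperm_mulsV.

(* [interval_fun a s] lets [s : 'S_m] act on [{a, ..., a + m - 1}] through
   [j |-> a + j], and fixes every other integer. *)
Definition interval_fun (a : int) (m : nat) (s : 'S_m) (z : int) : int :=
  if (z - a)%R is Posz i then
    if insub i is Some j then (a + Posz (s j))%R else z
  else z.

Lemma interval_fun_in a m (s : 'S_m) (j : 'I_m) :
  interval_fun a s (a + Posz j)%R = (a + Posz (s j))%R.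
Proof. by rewrite /interval_fun addrAC subrr add0r /= valK. Qed.

Lemma interval_fun_out a m (s : 'S_m) z :
  ~~ (a <= z < a + Posz m)%R -> interval_fun a s z = z.
Proof.
rewrite /interval_fun => z_out; case E : (z - a)%R => [i|//].
by case: insubP => // j jm _; lia.
Qed.

Lemma interval_case (a : int) (m : nat) (z : int) :
  (exists j : 'I_m, z = a + Posz j)%R \/ ~~ (a <= z < a + Posz m)%R.
Proof.
have [/andP[az zm]|] := boolP (a <= z < a + Posz m)%R; last by right.
have zm' : (`|z - a| < m)%N by lia.
by left; exists (Ordinal zm') => /=; lia.
Qed.

Lemma interval_funM a m (s t : 'S_m) z :
  interval_fun a (s * t) z = interval_fun a t (interval_fun a s z).
Proof.
have [[j ->]|z_out] := interval_case a m z.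
  by rewrite !interval_fun_in permM.
by rewrite !(interval_fun_out _ z_out).
Qed.

Lemma interval_fun1 a m z : interval_fun a (1 : 'S_m) z = z.
Proof.
have [[j ->]|z_out] := interval_case a m z.
  by rewrite interval_fun_in perm1.
by rewrite interval_fun_out.
Qed.

(* [Alt_f(Z)]: a finitely supported permutation is even when it restricts to an
   even permutation of some finite interval containing its support. *)
Definition alt_finZ : set zperm :=
  [set f | exists a m (s : 'S_m),
    s \in 'Alt_('I_m) /\ (f : int -> int) =1 interval_fun a s].

Section alt_prod.
Context (k : nat -> nat) (k_inc : {homo k : m n / (m < n)%N}).
Context (D : forall n, {group 'S_(k n.+1 - k n)}).

Lemma leq_k : {homo k : m n / (m <= n)%N}.
Proof. exact: ltnW_homo. Qed.

Lemma geq_k n : (n <= k n)%N.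
Proof. by elim: n => // n IHn; exact: leq_ltn_trans IHn (k_inc _). Qed.

Lemma block_index_subproof i : exists n, (i < k n.+1)%N.
Proof. by exists i; exact: geq_k. Qed.

(* If [k_n <= i < k_(n+1)], then [block_index i = n]. *)
Definition block_index (i : nat) : nat := ex_minn (block_index_subproof i).

Lemma block_indexE n i : (k n <= i < k n.+1)%N -> block_index i = n.
Proof.
move=> /andP[ni iSn]; rewrite /block_index; case: ex_minnP => p ip p_min.
apply/eqP; rewrite eqn_leq p_min //=.
have [//|pn] := leqP n p.
by have := leq_trans ip (leq_trans (leq_k pn) ni); rewrite ltnn.
Qed.

(* The sequence [x] of permutations, [x n] acting on
   [{k_n, ..., k_(n+1) - 1}]. *)
Definition blocks_fun (x : forall n, 'S_(k n.+1 - k n)) (z : int) : int :=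
  if z is Posz i then
    interval_fun (Posz (k (block_index i))) (x (block_index i)) z
  else z.

Lemma blocks_fun_in x n (j : 'I_(k n.+1 - k n)) :
  blocks_fun x (Posz (k n) + Posz j)%R = (Posz (k n) + Posz (x n j))%R.
Proof.
rewrite /blocks_fun -PoszD (@block_indexE n); last by have := ltn_ord j; lia.
by rewrite PoszD interval_fun_in.
Qed.

Lemma blocks_fun_out x z : (z < Posz (k 0))%R -> blocks_fun x z = z.
Proof.
case: z => // i ik; rewrite /blocks_fun.
have -> : block_index i = 0%N.
  have ik1 : (i < k 1)%N by apply: (@leq_trans (k 0)); [lia|exact: leq_k].
  rewrite /block_index; case: ex_minnP => p _ /(_ 0%N ik1).
  by rewrite leqn0 => /eqP.
by rewrite interval_fun_out //; lia.
Qed.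

Lemma blocks_case z :
  (z < Posz (k 0))%R \/
  exists n (j : 'I_(k n.+1 - k n)), z = (Posz (k n) + Posz j)%R.
Proof.
have [|kz] := boolP (z < Posz (k 0))%R; [by left|right].
case: z kz => [i|i]; last by lia.
move=> k0i; pose n := block_index i.
have [ni iSn] : (k n <= i)%N /\ (i < k n.+1)%N.
  rewrite /n /block_index; case: ex_minnP => -[|p] ip p_min; first by split; lia.
  split=> //; rewrite leqNgt; apply/negP => /p_min.
  by rewrite ltnn.
have jn : (i - k n < k n.+1 - k n)%N by lia.
by exists n, (Ordinal jn) => /=; lia.
Qed.

Lemma blocks_funM x y z :
  blocks_fun (fun n => x n * y n) z = blocks_fun y (blocks_fun x z).
Proof.
have [z0|[n [j ->]]] := blocks_case z; first by rewrite !blocks_fun_out.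
by rewrite !blocks_fun_in permM.
Qed.

Lemma blocks_fun1 x z : (forall n, x n = 1) -> blocks_fun x z = z.
Proof.
move=> x1; have [z0|[n [j ->]]] := blocks_case z.
  by rewrite blocks_fun_out.
by rewrite blocks_fun_in x1 perm1.
Qed.

Lemma blocks_fun_bij x : bijective (blocks_fun x).
Proof.
exists (blocks_fun (fun n => (x n)^-1)) => z; rewrite -blocks_funM.
  by apply: blocks_fun1 => n; rewrite mulgV.
by apply: blocks_fun1 => n; rewrite mulVg.
Qed.

(* The product topology of the finite discrete groups [D n]. *)
Definition prodD : topologicalType :=
  prod_topology (fun n => discrete_topology (subg_of (D n))).

Definition prodD_perm (x : prodD) : zperm :=
  ZPerm (blocks_fun_bij (fun n => sgval (x n))).

Definition alt_prod_set : set zperm :=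
  gen_subgroup (alt_finZ `|` range prodD_perm).

Definition alt_prod : Type := {f : zperm | f \in alt_prod_set}.

HB.instance Definition _ := SubChoice.on alt_prod.

Lemma alt_prod_closed : group_closed (fun f => f \in alt_prod_set).
Proof.
have [S1 SM SV] := gen_subgroupP (alt_finZ `|` range prodD_perm).
split=> [|f g]; first exact/mem_set.
move=> /set_mem Sf /set_mem Sg; apply/mem_set.
by apply: SM => //; exact: SV.
Qed.

HB.instance Definition _ :=
  SubChoice_isSubGroup.Build zperm (fun f => f \in alt_prod_set) alt_prod
    alt_prod_closed.

Lemma prodD_perm_in x : prodD_perm x \in alt_prod_set.
Proof.
by apply/mem_set; apply: sub_gen_smallest; apply: or_intror; exists x.
Qed.

Definition prodD_inc (x : prodD) : alt_prod :=
  Sub (prodD_perm x) (prodD_perm_in x).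

(* The topology for which [prodD] is an open subgroup with its product topology:
   see [prodD_inc_inj], [prodD_inc_continuous], [prodD_inc_open] and the
   uniqueness lemma [alt_prod_topology_unique]. *)
Definition alt_prod_open (U : set alt_prod) : Prop :=
  forall g : alt_prod, open [set x : prodD | U (g * prodD_inc x)].

Lemma alt_prod_openT : alt_prod_open setT.
Proof. by move=> g; exact: openT. Qed.

Lemma alt_prod_openI : setI_closed alt_prod_open.
Proof. by move=> A B oA oB g; exact: (openI (oA g) (oB g)). Qed.

Lemma alt_prod_open_bigU (I : Type) (f : I -> set alt_prod) :
  (forall i, alt_prod_open (f i)) -> alt_prod_open (\bigcup_i f i).
Proof. by move=> fo g; exact: (bigcup_open (D := setT) (fun i _ => fo i g)). Qed.

HB.instance Definition _ := isOpenTopological.Build alt_prod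
  alt_prod_openT alt_prod_openI alt_prod_open_bigU.

Definition prodD_mul (x y : prodD) : prodD :=
  fun n => (x n : subg_of (D n)) * (y n : subg_of (D n)).
Definition prodD_one : prodD := fun n => (1 : subg_of (D n)).
Definition prodD_inv (x : prodD) : prodD :=
  fun n => (x n : subg_of (D n))^-1.

Lemma prodD_ext (x y : prodD) : (forall n, x n = y n) -> x = y.
Proof. exact: functional_extensionality_dep. Qed.

Lemma prodD_mulA x y z :
  prodD_mul x (prodD_mul y z) = prodD_mul (prodD_mul x y) z.
Proof. by apply: prodD_ext => n; exact: mulgA. Qed.

Lemma prodD_mul1 x : prodD_mul x prodD_one = x.
Proof. by apply: prodD_ext => n; exact: mulg1. Qed.

Lemma prodD_mulV x : prodD_mul x (prodD_inv x) = prodD_one.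
Proof. by apply: prodD_ext => n; exact: mulgV. Qed.

Lemma prodD_mulVK x y : prodD_mul x (prodD_mul (prodD_inv x) y) = y.
Proof. by apply: prodD_ext => n; exact: mulKVg. Qed.

Lemma prodD_incM x y : prodD_inc (prodD_mul x y) = prodD_inc x * prodD_inc y.
Proof.
apply: val_inj; rewrite valM; apply: zperm_ext => z /=.
exact: (blocks_funM (fun n => sgval (x n)) (fun n => sgval (y n))).
Qed.

Lemma prodD_inc1 : prodD_inc prodD_one = 1.
Proof.
by apply: val_inj; rewrite val1; apply: zperm_ext => z; exact: blocks_fun1.
Qed.

Lemma prodD_incV x : prodD_inc (prodD_inv x) = (prodD_inc x)^-1.
Proof.
apply: (@mulgI _ (prodD_inc x)).
by rewrite mulgV -prodD_incM prodD_mulV prodD_inc1.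
Qed.

(* [tailD N x] means that [x] belongs to the product of the [D n], [n >= N]. *)
Definition tailD (N : nat) (x : prodD) : Prop :=
  forall n, (n < N)%N -> x n = prodD_one n.

Lemma tailDW M N x : (M <= N)%N -> tailD N x -> tailD M x.
Proof. by move=> MN xN n nM; apply: xN; exact: leq_trans nM MN. Qed.

Lemma tailDM N x y : tailD N x -> tailD N y -> tailD N (prodD_mul x y).
Proof.
by move=> xN yN n nN; rewrite /prodD_mul xN ?yN //; exact: mulg1.
Qed.

Lemma tailDV N x : tailD N x -> tailD N (prodD_inv x).
Proof.
by move=> xN n nN; rewrite /prodD_inv xN //; exact: invg1.
Qed.

Lemma openDP (W : set prodD) :
  open W <-> forall x, W x -> exists N, forall y, tailD N y -> W (prodD_mul x y).
Proof.
split=> [oW x Wx|H].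
  have /= Wn : nbhs x W by exact: open_nbhs_nbhs.
  pose F : set_system prodD :=
    filter_from [set: nat] (fun N => [set prodD_mul x y | y in tailD N]).
  have FF : Filter F.
    apply: filter_from_filter; first by exists 0%N.
    move=> M N _ _; exists (maxn M N) => // _ [y yMN <-].
    by split; exists y => //; apply: tailDW yMN; rewrite ?leq_maxl ?leq_maxr.
  have Fx : F --> x.
    apply/cvg_sup => n; apply/cvg_image => //.
      by apply/seteqP; split=> // a _; exists (dfwith x n a); rewrite ?dfwithin.
    move=> A xA; exists (fun y => A (y n)).
      exists n.+1 => // _ [y yn <-] /=.
      rewrite /prodD_mul yn // [X in A X]mulg1.
      exact: nbhs_singleton xA.
    apply/seteqP; split=> [_ [y Ay <-] //|a Aa].
    by exists (dfwith x n a); rewrite ?dfwithin.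
  have [N _ NW] := Fx _ Wn.
  by exists N => y yN; apply: NW; exists y.
rewrite openE => x /H [N NW].
have : \forall y \near x, forall n, (n < N)%N -> y n = x n.
  elim: N {NW} => [|N IHN]; first by apply: filterE.
  have xN : \forall y \near x, y N = x N.
    by apply: (@proj_continuous _ _ N x [set x N]); exact: discrete_set1.
  near=> y; move=> n; rewrite ltnS leq_eqVlt => /orP[/eqP ->|].
    by near: y.
  by move: n; near: y.
apply: filterS => y yx; rewrite -(prodD_mulVK x y); apply: NW => n nN.
by rewrite /prodD_mul /prodD_inv yx //; exact: mulVg.
Unshelve. all: by end_near. Qed.

Lemma openGP (U : set alt_prod) : open U <->
  forall g, U g -> exists N, forall y, tailD N y -> U (g * prodD_inc y).
Proof.
change (open U) with (alt_prod_open U).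
split=> [oU g Ug|H g].
  have [|N NU] := (openDP _).1 (oU g) prodD_one.
    by rewrite /= prodD_inc1 mulg1.
  exists N => y yN; move: (NU _ yN); congr U; rewrite /=.
  by rewrite prodD_incM prodD_inc1 mul1g.
apply/openDP => x /H [N NU]; exists N => y /NU /=.
by rewrite prodD_incM mulgA.
Qed.

Lemma nbhsGP (g : alt_prod) (A : set alt_prod) : nbhs g A <->
  exists N, forall y, tailD N y -> A (g * prodD_inc y).
Proof.
split.
  rewrite nbhsE => -[B [oB Bg] BA].
  by have [N NB] := (openGP B).1 oB g Bg; exists N => y /NB /BA.
move=> [N NA]; rewrite nbhsE.
exists [set g * prodD_inc y | y in tailD N]; last by move=> _ [y /NA ? <-].
split; last by exists prodD_one => //; rewrite prodD_inc1 mulg1.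
apply/openGP => _ [y yN <-]; exists N => z zN.
by exists (prodD_mul y z); [exact: tailDM|rewrite prodD_incM mulgA].
Qed.

(* Every element of the group normalises the product of the [D n] up to
   finitely many factors. *)
Definition almost_normalises (g : zperm) : Prop :=
  exists (c : prodD) N, forall y, tailD N y ->
    prodD_perm y * g =
    g * prodD_perm (prodD_mul (prodD_inv c) (prodD_mul y c)).

Lemma tailD_conj N c y : tailD N y ->
  tailD N (prodD_mul (prodD_inv c) (prodD_mul y c)).
Proof.
move=> yN n nN; rewrite /prodD_mul /prodD_inv yN // /prodD_one mul1g.
exact: mulVg.
Qed.

Lemma prodD_permM x y : prodD_perm (prodD_mul x y) = prodD_perm x * prodD_perm y.
Proof. by have /(congr1 val) := prodD_incM x y; rewrite valM. Qed.

Lemma almost_normalises_prodD x : almost_normalises (prodD_perm x).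
Proof.
exists x, 0%N => y _; rewrite -!prodD_permM; congr prodD_perm.
by rewrite prodD_mulVK.
Qed.

Lemma almost_normalises_alt g : alt_finZ g -> almost_normalises g.
Proof.
move=> [a [m [s [_ gs]]]]; exists prodD_one, (`|a| + m)%N => y yN.
have -> : prodD_mul (prodD_inv prodD_one) (prodD_mul y prodD_one) = y.
  by rewrite prodD_mul1; apply: prodD_ext => n;
    rewrite /prodD_mul /prodD_inv invg1 mul1g.
apply: zperm_ext => z /=; rewrite !gs.
have y_fix w : (w < Posz (k (`|a| + m)%N))%R ->
    blocks_fun (fun n => sgval (y n)) w = w.
  move=> wN; have [w0|[n [j wE]]] := blocks_case w; first exact: blocks_fun_out.
  rewrite wE blocks_fun_in yN ?perm1 // ltnNge; apply/negP => /leq_k; lia.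
have y_stay w : (Posz (k (`|a| + m)%N) <= w)%R ->
    (Posz (k (`|a| + m)%N) <= blocks_fun (fun n => sgval (y n)) w)%R.
  move=> Nw; have [w0|[n [j wE]]] := blocks_case w.
    by rewrite blocks_fun_out.
  rewrite wE blocks_fun_in.
  have [Nn|nN] := leqP (`|a| + m)%N n; first by have := leq_k Nn; lia.
  by have := leq_k nN; have := ltn_ord j; lia.
have kam := geq_k (`|a| + m)%N.
have [[j zE]|z_out] := interval_case a m z.
  rewrite y_fix; last by have := ltn_ord j; lia.
  rewrite y_fix // zE interval_fun_in.
  by have := ltn_ord (s j); have := ltn_ord j; lia.
rewrite (interval_fun_out _ z_out).
have [zN|Nz] := boolP (z < Posz (k (`|a| + m)%N))%R.
  by rewrite y_fix // interval_fun_out.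
rewrite interval_fun_out //.
have : (Posz (k (`|a| + m)%N) <= z)%R by lia.
by move=> /y_stay; lia.
Qed.

Lemma almost_normalisesM g h :
  almost_normalises g -> almost_normalises h -> almost_normalises (g * h).
Proof.
move=> [c [M gM]] [d [N hN]]; exists (prodD_mul c d), (maxn M N) => y yMN.
rewrite mulgA gM; last by apply: tailDW yMN; exact: leq_maxl.
rewrite -mulgA hN; last first.
  by apply: tailD_conj; apply: tailDW yMN; exact: leq_maxr.
rewrite mulgA; congr (_ * prodD_perm _); apply: prodD_ext => n.
by rewrite /prodD_mul /prodD_inv invgM !mulgA.
Qed.

Lemma almost_normalisesV g : almost_normalises g -> almost_normalises g^-1.
Proof.
move=> [c [N gN]]; exists (prodD_inv c), N => y yN.
apply: (@mulgI _ g); apply: (@mulIg _ g).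
rewrite mulgA mulgKV mulKVg gN; last first.
  exact: tailD_conj.
congr (_ * prodD_perm _); apply: prodD_ext => n.
by rewrite /prodD_mul /prodD_inv invgK !mulgA mulVg mul1g mulgKV.
Qed.

Lemma almost_normalisesP (g : alt_prod) : almost_normalises (val g).
Proof.
have /set_mem gS := valP g; apply: gS; split; last first.
  by move=> s [/almost_normalises_alt//|[x _ <-]]; exact: almost_normalises_prodD.
split; [|exact: almost_normalisesM|exact: almost_normalisesV].
exists prodD_one, 0%N => y _; rewrite mulg1 mul1g; congr prodD_perm.
by apply: prodD_ext => n; rewrite /prodD_mul /prodD_inv invg1 mul1g mulg1.
Qed.

Lemma prodD_inc_conj (g : alt_prod) : exists N0, forall N y, (N0 <= N)%N ->
  tailD N y -> exists2 y', tailD N y' & prodD_inc y * g = g * prodD_inc y'.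
Proof.
have [c [N0 gN]] := almost_normalisesP g; exists N0 => N y NN yN.
exists (prodD_mul (prodD_inv c) (prodD_mul y c)); first exact: tailD_conj.
by apply: val_inj; rewrite !valM /= gN //; exact: tailDW yN.
Qed.

Lemma alt_prod_mul_continuous :
  continuous (fun xy : alt_prod * alt_prod => xy.1 * xy.2).
Proof.
move=> [g h] A /nbhsGP [N NA] /=.
have [N0 hN] := prodD_inc_conj h; pose M := maxn N N0.
exists ([set g * prodD_inc y | y in tailD M],
        [set h * prodD_inc y | y in tailD M]).
  by split; apply/nbhsGP; exists M => y yM; exists y.
move=> [_ _] [/= [x xM <-] [y yM <-]] /=.
have [x' x'M hx] := hN M x (leq_maxr _ _) xM.
rewrite mulgA -[g * _ * h]mulgA hx !mulgA -mulgA -prodD_incM.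
apply: NA; apply: tailDM; exact: (tailDW (leq_maxl N N0)).
Qed.

Lemma alt_prod_inv_continuous : continuous (fun x : alt_prod => x^-1).
Proof.
move=> g A /nbhsGP [N NA].
have [N0 gN] := prodD_inc_conj g^-1; pose M := maxn N N0.
apply/nbhsGP; exists M => y yM /=.
have [y' y'M gy] := gN M _ (leq_maxr _ _) (tailDV yM).
rewrite invgM -prodD_incV gy.
by apply: NA; exact: (tailDW (leq_maxl N N0)).
Qed.

Lemma alt_prod_hausdorff : hausdorff_space alt_prod.
Proof.
move=> g h gh; apply: contrapT => neq_gh.
have [z zgh] : exists z : int, val (h^-1 * g) z <> z.
  apply: contrapT => /forallNP fixz; apply: neq_gh.
  apply: (@mulgI _ h^-1); rewrite mulVg; apply: val_inj; rewrite val1.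
  by apply: zperm_ext => z; have /contrapT := fixz z.
have [_ [[x xN <-] [y yN]]] := gh [set g * prodD_inc y | y in tailD `|z|.+1]
  [set h * prodD_inc y | y in tailD `|z|.+1]
  ((nbhsGP _ _).2 (ex_intro _ `|z|.+1 (fun y yN => ex_intro2 _ _ y yN erefl)))
  ((nbhsGP _ _).2 (ex_intro _ `|z|.+1 (fun y yN => ex_intro2 _ _ y yN erefl))).
move=> hy_gx; apply: zgh.
have -> : h^-1 * g = prodD_inc (prodD_mul y (prodD_inv x)).
  apply: (@mulgI _ h); apply: (@mulIg _ (prodD_inc x)).
  rewrite mulKVg -hy_gx -!mulgA; congr (h * _).
  by rewrite -prodD_incM; congr prodD_inc; apply: prodD_ext => n;
    rewrite /prodD_mul /prodD_inv mulgKV.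
rewrite /=; have [z0|[n [j zE]]] := blocks_case z; first exact: blocks_fun_out.
rewrite zE blocks_fun_in /prodD_mul /prodD_inv.
have nz : (n < `|z|.+1)%N by have := geq_k n; lia.
by rewrite xN // yN // /prodD_one mulgV perm1.
Qed.

Lemma prodD_compact : compact [set: prodD].
Proof.
have := @tychonoff nat (fun n => discrete_topology (subg_of (D n)))
  (fun=> setT).
rewrite (_ : [set f | _] = [set: prodD]); first apply.
  by move=> n; apply: finite_compact; exact: (@finite_finset (subg_of (D n))).
by apply/seteqP; split.
Qed.

Lemma prodD_inc_continuous : continuous prodD_inc.
Proof.
apply/continuousP => U oU; have := oU 1.
congr open; apply/seteqP; split=> x /=; by rewrite mul1g.
Qed.

Lemma prodD_inc_open (W : set prodD) : open W -> open (prodD_inc @` W).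
Proof.
move=> /openDP oW; apply/openGP => _ [x /oW [N NW] <-].
exists N => y /NW Wxy; exists (prodD_mul x y) => //.
by rewrite prodD_incM.
Qed.

Lemma prodD_inc_inj : injective prodD_inc.
Proof.
move=> x y /(congr1 val) /= xy; apply: prodD_ext => n.
apply: val_inj => /=; apply/permP => j.
have : blocks_fun (fun n => sgval (x n)) (Posz (k n) + Posz j)%R =
    blocks_fun (fun n => sgval (y n)) (Posz (k n) + Posz j)%R.
  exact: (congr1 (fun s : zperm => s (Posz (k n) + Posz j)%R) xy).
by rewrite !blocks_fun_in => /addrI [] /val_inj.
Qed.

Lemma open_range_prodD_inc : open (range prodD_inc).
Proof. by apply: prodD_inc_open; exact: openT. Qed.

Lemma alt_prod_topology_unique (O : set_system alt_prod) :
  (forall F : set_system alt_prod, F `<=` O -> O (\bigcup_(U in F) U)) ->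
  (forall g U, O U -> O [set x | U (g * x)]) ->
  (forall U, O U -> open (prodD_inc @^-1` U)) ->
  (forall W, open W -> O (prodD_inc @` W)) ->
  O = open.
Proof.
move=> OU OM Oc Oo; apply/seteqP; split=> U.
  by move=> UO; change (alt_prod_open U) => g; exact: (Oc _ (OM g _ UO)).
move=> oU; pose V g := [set x | [set prodD_inc y | y in
  [set y | U (g * prodD_inc y)]] (g^-1 * x)].
have -> : U = \bigcup_(W in range V) W.
  apply/seteqP; split=> [g Ug|g [_ [h _ <-]] [y /= Uy hg]].
    exists (V g); first by exists g.
    by exists prodD_one; rewrite /= prodD_inc1 ?mulg1 // mulVg.
  by move: Uy; rewrite hg mulKVg.
by apply: OU => _ [g _ <-]; apply: OM; apply: Oo; exact: oU.
Qed.

Lemma alt_prod_locally_compact : locally_compact [set: alt_prod].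
Proof.
move=> g _; exists [set g * prodD_inc x | x in [set: prodD]].
  rewrite withinET; apply/nbhsGP; exists 0%N => y _.
  by exists y.
have gC : compact [set g * prodD_inc x | x in [set: prodD]].
  apply: (@continuous_compact _ _ (fun x => g * prodD_inc x)).
    apply: continuous_subspaceT; apply/continuousP => U oU; exact: oU.
  exact: prodD_compact.
by split=> //; apply: compact_closed => //; exact: alt_prod_hausdorff.
Qed.

HB.instance Definition _ := isLCGroup.Build alt_prod alt_prod_mul_continuous
  alt_prod_inv_continuous alt_prod_hausdorff alt_prod_locally_compact.

End alt_prod.

(* Main.v *)
Require Import Defs.
From mathcomp Require Import all_boot all_order all_algebra all_fingroup.
From mathcomp Require Import all_solvable zify finmap.
From mathcomp Require Import all_classical all_reals all_analysis.

Set Implicit Arguments.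
Unset Strict Implicit.
Unset Printing Implicit Defensive.

Local Open Scope group_scope.
Local Open Scope classical_set_scope.

(** Every element of the group is the product of a finitely supported even
    permutation and of an element of the product of the [D n] with arbitrarily
    large indices ([alt_prod_decomp_tail]), so that the finitely supported even
    permutations are dense.  A closed subgroup [H] is therefore studied through
    the subgroups [level H M] of the permutations [f] supported in
    [{z | z < k M}] such that [H] contains [f] up to an element of the product of
    the [D n], [n >= M].  These two factors commute, and [H] is the whole group
    as soon as each [level H M] contains all even permutations of this half-line
    ([level_full]).

    Part (i).  Let [X] be a URS that does not contain [{1}].  By compactness of
    the closed subgroups, there is one window [W = {- N, ..., k N - 1}] such that
    every [H] in [X] contains an element that preserves [W], acts nontrivially
    on it, and acts on the right of [W] through the [D n] ([nontrivial_visible]).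
    As [X] is invariant under conjugation, [W] may be replaced by any set [P] of
    [#|W|] points of [{z | z < k N}], and the interval [{k N, ..., k M - 1}],
    where such an element acts in an uncontrolled way, may be moved to any set
    [L] of the right size that is disjoint from [P] ([visible_moved]).  The
    commutator of two such elements, one with the interval left in place and the
    other with the interval moved away, no longer involves the blocks [N] to
    [M - 1]; if the supports in [{z | z < k N}] meet in a single point, it is a
    three-cycle up to an element of the tail.  Hence any [#|W| ^ 2] points of the
    half-line support a three-cycle of [level H M] ([visible_cycle3]).  Two
    points are called related when a three-cycle of [level H M] passes through
    both; this is an equivalence relation, and [level H M] contains all
    three-cycles between points of a class.  There are thus fewer than
    [#|W| ^ 2] classes, some class is as large as one wants, and a conjugate of
    [H] contains, up to an element of the tail, all even permutations of any
    given finite set ([visible_alt]).  These conjugates converge to the whole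
    group, which is therefore in [X].

    Part (ii).  Let [H] have finite covolume.  The image of the product of the
    [D n], [n >= M], is open in [G/H] and countably many of its translates
    cover [G/H], so it has positive measure and only boundedly many of its
    translates are disjoint ([finite_covolume_level]).  This says that
    [level H M] has finite index in the even permutations of [{z | z < k M}];
    but this group has no proper subgroup of finite index ([finite_index_alt]),
    and [level_full] concludes. *)

(** * Permutations of the integers and their supports *)

Lemma zpermM (s t : zperm) z : (s * t) z = t (s z). Proof. by []. Qed.

Lemma zpermK (s : zperm) : cancel s (s^-1)%g.
Proof. by case: (zperm_invP s). Qed.

Lemma zpermKV (s : zperm) : cancel (s^-1)%g s.
Proof. by case: (zperm_invP s). Qed.

Lemma zperm_inj (s : zperm) : injective s.
Proof. exact: can_inj (zpermK s). Qed.

Lemma zperm_conjE (f g : zperm) z : (f ^ g) z = g (f (g^-1 z)).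
Proof. by []. Qed.

Definition supported (A : set int) (f : zperm) : Prop :=
  forall z, ~ A z -> f z = z.

Lemma supportedS A B f : A `<=` B -> supported A f -> supported B f.
Proof. by move=> AB fA z Bz; apply: fA => /AB. Qed.

Lemma supported_mem A (f : zperm) z : supported A f -> A z -> A (f z).
Proof.
move=> fA Az; apply: contrapT => /[dup] Afz /fA /zperm_inj fzz.
by apply: Afz; rewrite fzz.
Qed.

Lemma supported_moved A (f : zperm) z : supported A f -> f z <> z -> A z.
Proof. by move=> fA fz; apply: contrapT => /fA. Qed.

Lemma supported_group A : is_subgroup (supported A).
Proof.
split=> [//|f g fA gA z Az|f fA z Az]; first by rewrite zpermM fA ?gA.
by apply: (@zperm_inj f); rewrite zpermKV fA.
Qed.

Lemma supported_conj A B (f g : zperm) :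
  (forall z, A (g z) -> B z) -> supported A f -> supported B (f ^ g^-1).
Proof.
move=> gAB fA z Bz; rewrite zperm_conjE invgK fA ?zpermK //.
by move=> /gAB.
Qed.

Lemma supported_commute A B f g : A `&` B = set0 ->
  supported A f -> supported B g -> f * g = g * f.
Proof.
move=> AB fA gB; apply: zperm_ext => z; rewrite !zpermM.
have [Az|Az] := pselect (A z).
  have disj w : A w -> ~ B w by move=> Aw Bw; rewrite -[False]/(set0 w) -AB.
  by rewrite !gB //; apply: disj => //; exact: (supported_mem fA).
rewrite (fA z Az); have [Bz|Bz] := pselect (B z); last by rewrite gB // fA.
rewrite fA // => Agz; have := supported_mem gB Bz => Bgz.
by rewrite -[False]/(set0 (g z)) -AB.
Qed.

Lemma moved_point (f : zperm) : f <> 1 -> exists z, f z <> z.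
Proof.
move=> f1; apply: contrapT => /forallNP fixz; apply: f1.
by apply: zperm_ext => z; have /contrapT := fixz z.
Qed.

Section subgroup.
Context (L : set zperm) (gL : is_subgroup L).

Lemma subgroupM f g : L f -> L g -> L (f * g).
Proof. by case: gL => _ + _; apply. Qed.

Lemma subgroupV f : L f -> L f^-1.
Proof. by case: gL => _ _; apply. Qed.

Lemma subgroupJ f g : L f -> L g -> L (f ^ g).
Proof. by move=> Lf Lg; do !apply: subgroupM => //; exact: subgroupV. Qed.

End subgroup.

(** * Three-cycles *)

Definition zswap_fun (x y z : int) : int :=
  if z == x then y else if z == y then x else z.

Lemma zswap_funK x y : involutive (zswap_fun x y).
Proof.
move=> z; rewrite /zswap_fun; case: (eqVneq z x) => [->|zx].
  by rewrite eqxx; case: (eqVneq y x).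
case: (eqVneq z y) => [->|zy]; first by rewrite eqxx.
by rewrite (negPf zx) (negPf zy).
Qed.

Definition zswap x y : zperm := ZPerm (inv_bij (zswap_funK x y)).

Lemma zswapJ x y (g : zperm) : zswap x y ^ g = zswap (g x) (g y).
Proof.
apply: zperm_ext => z; rewrite zperm_conjE /= /zswap_fun.
rewrite -(inj_eq (@zperm_inj g) _ x) -(inj_eq (@zperm_inj g) _ y) zpermKV.
by case: ifP => // _; case: ifP => // _; rewrite zpermKV.
Qed.

Lemma zswapV x y : (zswap x y)^-1 = zswap x y.
Proof.
by apply: mulg1_eq; apply: zperm_ext => z; rewrite zpermM /= zswap_funK.
Qed.

(** When [x], [y], [z] are distinct, the three-cycle [x -> y -> z -> x]. *)
Definition cycle3 x y z : zperm := zswap x y * zswap x z.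

Lemma cycle3E x y z w : uniq [:: x; y; z] -> cycle3 x y z w =
  if w == x then y else if w == y then z else if w == z then x else w.
Proof.
rewrite [uniq _]/= !inE andbT negb_or => /andP[/andP[xy xz] yz].
rewrite /cycle3 zpermM /= /zswap_fun.
case: (eqVneq w x) => [_|wx].
  by rewrite eq_sym (negPf xy) (negPf yz).
by case: (eqVneq w y) => [_|wy]; rewrite ?eqxx // (negPf wx).
Qed.

Lemma cycle3_1 x y z : uniq [:: x; y; z] -> cycle3 x y z x = y.
Proof. by move=> u; rewrite cycle3E // eqxx. Qed.

Lemma cycle3_2 x y z : uniq [:: x; y; z] -> cycle3 x y z y = z.
Proof.
move=> u; rewrite cycle3E // eqxx; case: eqVneq => // yx.
by move: u; rewrite /= yx !inE eqxx.
Qed.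

Lemma cycle3_out x y z w : w \notin [:: x; y; z] -> cycle3 x y z w = w.
Proof.
rewrite !inE !negb_or => /and3P[wx wy wz].
rewrite /cycle3 zpermM /= /zswap_fun.
by rewrite (negPf wx) (negPf wy) (negPf wx) (negPf wz).
Qed.

Lemma cycle3V x y z : (cycle3 x y z)^-1 = cycle3 x z y.
Proof. by rewrite /cycle3 invgM !zswapV. Qed.

Lemma cycle3J x y z (g : zperm) :
  cycle3 x y z ^ g = cycle3 (g x) (g y) (g z).
Proof. by rewrite /cycle3 conjMg !zswapJ. Qed.

Lemma cycle3_rot x y z : uniq [:: x; y; z] -> cycle3 x y z = cycle3 y z x.
Proof.
move=> u; have u' : uniq [:: y; z; x] by rewrite -(rot_uniq 1) in u.
apply: zperm_ext => w; rewrite !cycle3E //.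
case: (eqVneq w x) => [wx|_]; case: (eqVneq w y) => [wy|_];
  case: (eqVneq w z) => [wz|_] //; move: u;
  by rewrite -?wx -?wy -?wz /= !inE eqxx ?orbT ?andbF.
Qed.

Lemma supported_cycle3 (A : set int) x y z :
  A x -> A y -> A z -> supported A (cycle3 x y z).
Proof.
move=> Ax Ay Az w Aw; apply: cycle3_out; rewrite !inE.
by apply/negP => /or3P[] /eqP wE; apply: Aw; rewrite wE.
Qed.

(** A point other than [p] is moved by at most one of [a] and [b], so the
    commutator can only move [p] and its preimages by [a] and [b]. *)
Lemma commutator_cycle3 (a b : zperm) p : a p <> p -> b p <> p ->
    (forall z, z <> p -> a z <> z -> b z = z) ->
  let u := (a^-1)%g p in let v := (b^-1)%g p in
  uniq [:: u; p; v] /\ a * b * a^-1 * b^-1 = cycle3 u p v.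
Proof.
move=> ap bp ab u v.
have au : a u = p by rewrite zpermKV.
have bv : b v = p by rewrite zpermKV.
have up : u <> p by move=> E; apply: ap; rewrite -{1}E.
have vp : v <> p by move=> E; apply: bp; rewrite -{1}E.
have ba z : z <> p -> b z <> z -> a z = z.
  by move=> zp bz; apply: contrapT => /(ab _ zp).
have av : a v = v by apply: ba; rewrite ?bv //; exact/nesym.
have bu : b u = u by apply: ab; rewrite ?au //; exact/nesym.
have uv : u <> v by move=> E; apply: up; rewrite -bu E bv.
have uniq_upv : uniq [:: u; p; v].
  rewrite /= !inE negb_or andbT.
  by apply/andP; split; [apply/andP; split|]; apply/eqP => // /esym.
split=> //; apply: zperm_ext => z; rewrite cycle3E // !zpermM.
have bE w t : b t = w -> (b^-1)%g w = t by move=> <-; rewrite zpermK.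
have aE w t : a t = w -> (a^-1)%g w = t by move=> <-; rewrite zpermK.
case: eqP => [->|zu].
  rewrite au; apply: bE; symmetry; apply: aE.
  by apply: ba => // /zperm_inj.
case: eqP => [->|zp].
  by rewrite (ab (a p)) ?zpermK // => /zperm_inj.
case: eqP => [->|zv]; first by rewrite av bv -/u; exact: bE.
have [az|az] := pselect (a z = z).
  rewrite az; apply: bE; symmetry; apply: aE.
  have [bz|bz] := pselect (b z = z); first by rewrite bz.
  apply: ba => [bzp|/zperm_inj //]; apply: zv.
  by apply: (@zperm_inj b); rewrite bzp bv.
rewrite (ab (a z)) ?zpermK; first by apply: bE; exact: ab.
  by move=> azp; apply: zu; apply: (@zperm_inj a); rewrite azp au.
by move=> /zperm_inj.
Qed.

Lemma uniq3P (T : eqType) (x y z : T) :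
  reflect [/\ x <> y, x <> z & y <> z] (uniq [:: x; y; z]).
Proof.
rewrite /= !inE negb_or andbT -andbA.
by apply: (iffP and3P) => -[/eqP ? /eqP ? /eqP ?].
Qed.

(** * Points joined by a three-cycle *)

Section related.
Context (L : set zperm) (gL : is_subgroup L).

Definition related x y : Prop :=
  x = y \/ exists2 z, uniq [:: x; y; z] & L (cycle3 x y z).

Lemma related_sym x y : related x y -> related y x.
Proof.
move=> [->|[z /uniq3P[xy xz yz] Lxyz]]; [by left|right].
exists z; first by apply/uniq3P; split=> //; exact/nesym.
rewrite cycle3_rot; last by apply/uniq3P; split=> //; exact/nesym.
by rewrite -cycle3V; exact: subgroupV.
Qed.

Lemma related_trans y x z : related x y -> related y z -> related x z.
Proof.
move=> [->//|[w /uniq3P[xy xw yw] Lxyw]].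
move=> [<-|[v /uniq3P[yz yv zv] Lyzv]].
  by right; exists w => //; exact/uniq3P.
have [->|/eqP xz] := eqVneq x z; [by left|right].
have [vx|/eqP vx] := eqVneq v x.
  exists y; first by apply/uniq3P; split=> //; exact/nesym.
  rewrite -cycle3V; apply: subgroupV => //.
  by rewrite cycle3_rot -?vx //; apply/uniq3P; split=> //; rewrite vx.
have uyzv : uniq [:: y; z; v] by exact/uniq3P.
have tx : cycle3 y z v x = x.
  by apply: cycle3_out; rewrite !inE; apply/negP => /or3P[] /eqP // /esym.
have := subgroupJ gL Lxyw Lyzv; rewrite cycle3J tx cycle3_1 // => Lxzw.
exists (cycle3 y z v w) => //; apply/uniq3P; split=> //.
  by move=> E; apply: xw; apply: (@zperm_inj (cycle3 y z v)); rewrite -E.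
by move=> E; apply: yw; apply: (@zperm_inj (cycle3 y z v)); rewrite -E cycle3_1.
Qed.

(** If [x -> y -> w] and [w -> z -> v] are in [L], conjugating the first by the
    second (or by its inverse, if the two cycles share a second point) replaces
    [w] by [z]. *)
Lemma related_cycle3 x y z : uniq [:: x; y; z] ->
  related x y -> related x z -> L (cycle3 x y z).
Proof.
move=> /uniq3P[xy xz yz] rxy rxz.
case: (rxy) => [//|[w /uniq3P[_ xw yw] Lxyw]].
have [->//|/eqP zw] := eqVneq z w.
have [wz|[v /uniq3P[_ wv zv] Lwzv]] : related w z.
  apply: related_trans rxz; right; exists y.
    by apply/uniq3P; split => //; exact/nesym.
  by rewrite cycle3_rot //; apply/uniq3P; split=> //; exact/nesym.
  by case: zw.
have [vx|/eqP vx] := eqVneq v x.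
  have := subgroupJ gL Lxyw (subgroupV gL Lwzv); rewrite cycle3V vx cycle3J.
  have u : uniq [:: w; x; z] by apply/uniq3P; split=> //; exact/nesym.
  rewrite cycle3_1 // cycle3_2 // cycle3_out; last first.
    by rewrite !inE; apply/negP => /or3P[] /eqP // /esym.
  rewrite cycle3_rot; last by apply/uniq3P; split=> //; exact/nesym.
  rewrite cycle3_rot; last by apply/uniq3P; split=> //; exact/nesym.
  by move=> /(subgroupV gL); rewrite cycle3V.
have [vy|/eqP vy] := eqVneq v y.
  have := subgroupJ gL Lxyw (subgroupV gL Lwzv); rewrite cycle3V vy cycle3J.
  have u : uniq [:: w; y; z] by apply/uniq3P; split=> //; exact/nesym.
  rewrite cycle3_1 // cycle3_2 // cycle3_out; last first.
    by rewrite !inE; apply/negP => /or3P[] /eqP // /esym.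
  by move=> /(subgroupV gL); rewrite cycle3V.
have := subgroupJ gL Lxyw Lwzv; rewrite cycle3J.
have u : uniq [:: w; z; v] by apply/uniq3P; split=> //; exact/nesym.
rewrite cycle3_1 // cycle3_out; last first.
  by rewrite !inE; apply/negP => /or3P[] /eqP // /esym.
rewrite cycle3_out //.
by rewrite !inE; apply/negP => /or3P[] /eqP // /esym.
Qed.

(** By induction on [n]: the class of the first point either has [r] elements,
    or can be removed at the cost of fewer than [r] points. *)
Lemma related_or_unrelated n r (Y : seq int) : (0 < r)%N -> uniq Y ->
    (n * r <= size Y)%N ->
  (exists E, [/\ uniq E, size E = r, {subset E <= Y} &
     {in E &, forall x y, related x y}]) \/
  (exists Z, [/\ uniq Z, size Z = n, {subset Z <= Y} &
     {in Z &, forall x y, related x y -> x = y}]).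
Proof.
move=> r0; elim: n Y => [|n IHn] Y uY sY; first by right; exists [::].
case: Y => [|y Y'] in uY sY *; first by move: sY => /=; lia.
set Y := y :: Y' in uY sY *.
pose p x := `[< related y x >]; pose E := seq.filter p Y.
have [rE|Er] := leqP r (size E).
  left; exists (take r E); split.
  - by apply: take_uniq; exact: filter_uniq.
  - by rewrite size_takel.
  - by move=> x /mem_take; rewrite mem_filter => /andP[].
  move=> x z /mem_take + /mem_take; rewrite !mem_filter.
  move=> /andP[/asboolP yx _] /andP[/asboolP yz _].
  by apply: related_trans yz; exact: related_sym.
have [||[F [? ? FY ?]]|[Z [uZ sZ ZY Zr]]] := IHn (seq.filter (predC p) Y).
- exact: filter_uniq.
- rewrite size_filter -(leq_add2l (count p Y)) count_predC.
  by apply: leq_trans sY; rewrite mulSn leq_add2r -size_filter ltnW.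
- left; exists F; split=> // x /FY; rewrite mem_filter => /andP[] //.
right; exists (y :: Z).
have Zy z : z \in Z -> ~ related y z.
  by move=> /ZY; rewrite mem_filter => /andP[/= /asboolP].
split.
- by rewrite /= uZ andbT; apply/negP => /Zy; apply; left.
- by rewrite /= sZ.
- move=> x; rewrite inE => /orP[/eqP->|/ZY]; first by rewrite inE eqxx.
  by rewrite mem_filter => /andP[].
move=> x z; rewrite !inE => /orP[/eqP->|xZ] /orP[/eqP->|zZ] //.
- by move=> /Zy; case.
- by move=> /related_sym /Zy; case.
- exact: Zr.
Qed.

End related.

(** Two points of a three-cycle of [L] are related, hence [n] points cannot be
    pairwise unrelated, and the other case of [related_or_unrelated] holds. *)
Lemma cycle3_clique (L : set zperm) n r (Y : seq int) : is_subgroup L ->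
    uniq Y -> (n * r.+1 <= size Y)%N ->
    (forall Z, uniq Z -> size Z = n -> {subset Z <= Y} ->
      exists x y z, [/\ uniq [:: x; y; z], {subset [:: x; y; z] <= Z} &
        L (cycle3 x y z)]) ->
  exists E, [/\ uniq E, size E = r.+1, {subset E <= Y} &
    forall x y z, uniq [:: x; y; z] -> {subset [:: x; y; z] <= E} ->
      L (cycle3 x y z)].
Proof.
move=> gL uY sY LY.
have [[E [uE sE EY rE]]|[Z [uZ sZ ZY rZ]]] := related_or_unrelated gL (ltn0Sn r) uY sY.
  exists E; split=> // x y z u xyzE; apply: related_cycle3 => //;
    by apply: rE; apply: xyzE; rewrite !inE eqxx ?orbT.
have [x [y [z [u xyz Lxyz]]]] := LY Z uZ sZ ZY.
case/uniq3P: (u) => xy _ _; case: xy; apply: rZ.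
- by apply: xyz; rewrite inE eqxx.
- by apply: xyz; rewrite !inE eqxx orbT.
- by right; exists z.
Qed.

(** * Finitely supported even permutations *)

(** The finitely supported even permutations of [A], in the form that the proof
    needs: a subgroup contains [alt_on A] as soon as it contains the three-cycles
    of [A]. *)
Definition alt_on (A : set int) : set zperm :=
  gen_subgroup [set cycle3 w.1.1 w.1.2 w.2 | w in
    [set w | uniq [:: w.1.1; w.1.2; w.2] /\ [set` [:: w.1.1; w.1.2; w.2]] `<=` A]].

Lemma alt_on_group A : is_subgroup (alt_on A).
Proof. exact: gen_subgroupP. Qed.

Lemma alt_on_cycle3 (A : set int) x y z :
  uniq [:: x; y; z] -> A x -> A y -> A z -> alt_on A (cycle3 x y z).
Proof.
move=> u Ax Ay Az; apply: sub_gen_smallest; exists (x, y, z) => //; split=> // w.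
by rewrite /= !inE => /or3P[] /eqP ->.
Qed.

Lemma alt_on_sub A L : is_subgroup L ->
    (forall x y z, uniq [:: x; y; z] -> A x -> A y -> A z -> L (cycle3 x y z)) ->
  alt_on A `<=` L.
Proof.
move=> gL AL f; apply; split=> // _ [[[x y] z] [/= u xyzA] <-].
by apply: AL => //; apply: xyzA; rewrite /= !inE eqxx ?orbT.
Qed.

Lemma alt_onS A B : A `<=` B -> alt_on A `<=` alt_on B.
Proof.
move=> AB; apply: alt_on_sub; first exact: alt_on_group.
by move=> x y z u /AB Bx /AB By /AB Bz; exact: alt_on_cycle3.
Qed.

Lemma alt_on_supported A f : alt_on A f -> supported A f.
Proof.
apply: (@alt_on_sub _ (supported A)); first exact: supported_group.
by move=> x y z _ Ax Ay Az; apply: supported_cycle3.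
Qed.

Lemma alt_onJ f g : alt_on setT f -> alt_on setT (f ^ g).
Proof.
have gT := alt_on_group setT.
apply: (@alt_on_sub _ [set f | alt_on setT (f ^ g)]).
  split=> [|f1 f2 /= ? ?|f1 /= ?].
  - by rewrite /= conj1g; case: gT.
  - by rewrite conjMg; exact: (subgroupM gT).
  - by rewrite conjVg; exact: (subgroupV gT).
move=> x y z u _ _ _ /=; rewrite cycle3J; apply: alt_on_cycle3 => //.
by rewrite -(map_inj_uniq (@zperm_inj g)) in u.
Qed.

Definition zball (n : nat) : set int := [set x | (`|x| < n)%N].

Definition zbelow (b : int) : set int := [set x | (x < b)%R].

Lemma alt_on_zball f : alt_on setT f -> exists n, alt_on (zball n) f.
Proof.
have zballS m n : (m <= n)%N -> zball m `<=` zball n.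
  by move=> mn x /leq_trans; apply.
apply: (@alt_on_sub _ [set f | exists n, alt_on (zball n) f]).
  split=> [|{}f g [m fm] [n gn]|{}f [n fn]].
  - by exists 0%N; case: (alt_on_group (zball 0)).
  - exists (maxn m n); apply: (subgroupM (alt_on_group _)).
      by apply: (alt_onS _ fm); apply: zballS; exact: leq_maxl.
    by apply: (alt_onS _ gn); apply: zballS; exact: leq_maxr.
  - by exists n; exact: (subgroupV (alt_on_group _)).
move=> x y z u _ _ _; exists (`|x| + `|y| + `|z|).+1.
by apply: alt_on_cycle3; rewrite // /zball /=; lia.
Qed.

Lemma exists_fresh (b : int) n (s : seq int) : exists L : seq int,
  [/\ uniq L, size L = n, [set` L] `<=` zbelow b & forall x, x \in L -> x \notin s].
Proof.
have [c cs] : exists c : int, forall x, x \in s -> (c <= x)%R.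
  elim: s => [|y s [c cs]]; first by exists 0%R.
  exists (Num.min c y) => x; rewrite inE => /orP[/eqP->|/cs]; lia.
exists [seq (Num.min b c - Posz i.+1)%R | i <- iota 0 n]; split.
- by rewrite map_inj_uniq ?iota_uniq // => i j; lia.
- by rewrite size_map size_iota.
- by move=> _ /mapP[i _ ->]; rewrite /zbelow /=; lia.
by move=> _ /mapP[i _ ->]; apply/negP => /cs; lia.
Qed.

(** High transitivity, by induction on the lists: an element is moved to its
    target by a three-cycle whose third point is chosen away from the part of
    the list that is already in place. *)
Lemma alt_on_transitive (b : int) (s t : seq int) : uniq s -> uniq t ->
    size s = size t -> [set` s] `<=` zbelow b -> [set` t] `<=` zbelow b ->
  exists2 g, alt_on (zbelow b) g & map g s = t.
Proof.
elim: s t => [|x s IHs] [|y t] //=.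
  by move=> *; exists 1 => //; case: (alt_on_group (zbelow b)).
move=> /andP[xs us] /andP[yt ut] [st] sb tb.
have [g gb gst] : exists2 g, alt_on (zbelow b) g & map g s = t.
  have sub u v : [set` u :: v] `<=` zbelow b -> [set` v] `<=` zbelow b.
    by move=> uv z zv; apply: uv; rewrite /= inE; apply/orP; right.
  by apply: IHs => //; [exact: sub sb|exact: sub tb].
have yb : zbelow b y by apply: tb; rewrite /= inE eqxx.
have gxb : zbelow b (g x).
  by apply: (supported_mem (alt_on_supported gb)); apply: sb; rewrite /= inE eqxx.
have gxt : g x \notin t by rewrite -gst (mem_map (@zperm_inj g)).
have [gxy|/eqP gxy] := eqVneq (g x) y; first by exists g; rewrite ?gst ?gxy.
have [[|z [|? ?]] [_ // _ zb zF]] := exists_fresh b 1 [:: g x, y & t].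
have {}zb : zbelow b z by apply: zb; rewrite /= inE.
have := zF z; rewrite !inE eqxx => /(_ isT).
rewrite !negb_or => /and3P[/eqP zgx /eqP zy zt].
have u : uniq [:: g x; y; z] by apply/uniq3P; split=> //; exact/nesym.
exists (g * cycle3 (g x) y z).
  by apply: (subgroupM (alt_on_group _)) => //; exact: alt_on_cycle3.
congr (_ :: _); first by rewrite zpermM cycle3_1.
rewrite -gst -[in RHS](map_id (map g s)) -map_comp; apply/eq_in_map => w ws /=.
rewrite -[LHS]/(cycle3 (g x) y z (g w)) cycle3_out // !inE.
have : g w \in t by rewrite -gst; exact: map_f.
by move=> wt; rewrite !negb_or; apply/and3P; split; apply/eqP => E;
  move: wt; rewrite E ?(negPf gxt) ?(negPf yt) ?(negPf zt).
Qed.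

Lemma zswapC x y : zswap x y = zswap y x.
Proof.
apply: zperm_ext => z; rewrite /= /zswap_fun.
by case: (eqVneq z x) => [<-|_]; case: eqVneq.
Qed.

(** Insert [zswap y z * zswap y z] to get two pairs of transpositions with a
    common point. *)
Lemma zswap_pair_alt x y z w : x != y -> z != w ->
  alt_on setT (zswap x y * zswap z w).
Proof.
have gT := alt_on_group setT.
have chain u v t : u != v -> v != t -> alt_on setT (zswap u v * zswap v t).
  move=> /eqP uv /eqP vt; have [<-|/eqP ut] := eqVneq u t.
    by rewrite (zswapC v u) -[X in X * _]zswapV mulVg; case: gT.
  rewrite (zswapC u v); apply: alt_on_cycle3 => //.
  by apply/uniq3P; split=> //; exact/nesym.
move=> xy; have [<-|yz zw] := eqVneq y z; first exact: chain.
have := subgroupM gT (chain _ _ _ xy yz) (chain _ _ _ yz zw).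
by rewrite mulgA -[_ * _ * zswap y z]mulgA -{1}(zswapV y z) mulVg mulg1.
Qed.

Lemma interval_fun_bij a m (s : 'S_m) : bijective (interval_fun a s).
Proof.
exists (interval_fun a s^-1) => z; rewrite -interval_funM ?mulgV ?mulVg;
  exact: interval_fun1.
Qed.

Definition zinterval a m (s : 'S_m) : zperm := ZPerm (interval_fun_bij a s).

Lemma zintervalM a m (s t : 'S_m) :
  zinterval a (s * t) = zinterval a s * zinterval a t.
Proof. by apply: zperm_ext => z; exact: interval_funM. Qed.

Lemma zinterval_tperm a m (i j : 'I_m) :
  zinterval a (tperm i j) = zswap (a + Posz i)%R (a + Posz j)%R.
Proof.
apply: zperm_ext => z /=; rewrite /zswap_fun.
have [[l ->]|z_out] := interval_case a m z.
  rewrite interval_fun_in !(inj_eq (@GRing.addrI _ a)) !eqz_nat !val_eqE.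
  by case: tpermP => [->|->|/eqP/negPf-> /eqP/negPf->//];
    rewrite eqxx //; case: eqVneq => [->|].
rewrite interval_fun_out //; have := ltn_ord i; have := ltn_ord j.
by case: eqP => [?|_]; [lia|case: eqP => //; lia].
Qed.

Lemma zinterval1 a m : zinterval a (1 : 'S_m) = 1.
Proof. by apply: zperm_ext => z; exact: interval_fun1. Qed.

(** An even permutation is a product of an even number of transpositions, which
    are grouped in pairs. *)
Lemma zinterval_alt a m (s : 'S_m) : s \in 'Alt_('I_m) ->
  alt_on setT (zinterval a s).
Proof.
have [ts -> dts] := prod_tpermP s.
rewrite Alt_even odd_perm_prod //.
have [n] := ubnP (size ts); elim: n ts dts => // n IHn.
case=> [|t [|u ts]] //=.
  by move=> _ _ _; rewrite big_nil zinterval1; case: (alt_on_group setT).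
move=> /and3P[dt du dts] tsn; rewrite negbK => ts_even.
rewrite !big_cons !zintervalM mulgA; apply: (subgroupM (alt_on_group _)).
  rewrite !zinterval_tperm; apply: zswap_pair_alt;
  by rewrite (inj_eq (@GRing.addrI _ a)) eqz_nat.
by apply: IHn => //; exact: ltnW.
Qed.

Lemma alt_finZ_alt f : alt_finZ f -> alt_on setT f.
Proof.
move=> [a [m [s [sA fs]]]]; rewrite (_ : f = zinterval a s).
  exact: zinterval_alt.
exact: zperm_ext.
Qed.

Lemma cycle3_alt_finZ (x y z : int) : uniq [:: x; y; z] -> alt_finZ (cycle3 x y z).
Proof.
pose m := (`|x| + `|y| + `|z|).+1.
have mz w : (`|w| < m)%N -> exists i : 'I_(m + m), w = (Posz i - Posz m)%R.
  move=> wm; have im : (`|(w + Posz m)%R| < m + m)%N by lia.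
  by exists (Ordinal im) => /=; lia.
have [i xE] : exists i : 'I_(m + m), x = (Posz i - Posz m)%R by apply: mz; lia.
have [j yE] : exists i : 'I_(m + m), y = (Posz i - Posz m)%R by apply: mz; lia.
have [l zE] : exists i : 'I_(m + m), z = (Posz i - Posz m)%R by apply: mz; lia.
move=> /uniq3P[xy xz yz]; exists (- Posz m)%R, (m + m)%N, (tperm i j * tperm i l).
split.
  rewrite Alt_even odd_permM !odd_tperm.
  have -> : i != j by apply/eqP => ij; apply: xy; rewrite xE yE ij.
  by have -> : i != l by apply/eqP => ij; apply: xz; rewrite xE zE ij.
move=> w; rewrite -[RHS]/(zinterval _ _ w) zintervalM !zinterval_tperm.
by rewrite !(GRing.addrC (- Posz m)%R) -xE -yE -zE.
Qed.

(** * Decomposing the elements of the group *)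

Section decomposition.
Context (k : nat -> nat) (k_inc : {homo k : m n / (m < n)%N}).
Context (D : forall n, {group 'S_(k n.+1 - k n)}).
Hypothesis D_alt : forall n, D n \subset 'Alt_('I_(k n.+1 - k n)).
Local Notation prodD_perm := (@prodD_perm k k_inc D).

Lemma alt_on_alt_prod f : alt_on setT f -> f \in alt_prod_set k_inc D.
Proof.
move=> fA; apply/mem_set; move: f fA.
apply: alt_on_sub; first exact: gen_subgroupP.
move=> x y z u _ _ _; apply: sub_gen_smallest; left.
exact: cycle3_alt_finZ.
Qed.

Definition headD (N : nat) (x : prodD D) : prodD D :=
  fun n => if (n < N)%N then x n else prodD_one D n.

Lemma headDK N (x : prodD D) :
  exists2 t, tailD N t & x = prodD_mul (headD N x) t.
Proof.
exists (fun n => if (n < N)%N then prodD_one D n else x n).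
  by move=> n nN; rewrite /= nN.
apply: prodD_ext => n; rewrite /prodD_mul /headD.
by case: ifP => _; [rewrite [RHS]mulg1|rewrite [RHS]mul1g].
Qed.

Lemma prodD_perm_one : prodD_perm (prodD_one D) = 1.
Proof. by apply: zperm_ext => z; apply: blocks_fun1. Qed.

Lemma prodD_perm_fix N x z : tailD N x -> (z < Posz (k N))%R ->
  prodD_perm x z = z.
Proof.
move=> xN zN /=; have [z0|[n [j zE]]] := blocks_case k_inc z.
  by rewrite blocks_fun_out.
rewrite zE blocks_fun_in xN ?perm1 // ltnNge; apply/negP => /(leq_k k_inc).
by move: zN; rewrite zE; lia.
Qed.

Lemma headD_perm_fix N x z : (Posz (k N) <= z)%R ->
  prodD_perm (headD N x) z = z.
Proof.
move=> Nz /=; have [z0|[n [j zE]]] := blocks_case k_inc z.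
  by rewrite blocks_fun_out.
rewrite zE blocks_fun_in /headD; case: ifP => [nN|_]; last by rewrite perm1.
by have := leq_k k_inc nN; have := ltn_ord j; move: Nz; rewrite zE; lia.
Qed.

(** Each of the finitely many factors is an even permutation of an interval. *)
Lemma headD_alt N x : alt_on setT (prodD_perm (headD N x)).
Proof.
have gT := alt_on_group setT.
elim: N => [|N IHN].
  rewrite (_ : headD 0 x = prodD_one D) ?prodD_perm_one; first by case: gT.
  exact: prodD_ext.
pose y : prodD D := fun n => if n == N then x n else prodD_one D n.
have -> : headD N.+1 x = prodD_mul (headD N x) y.
  apply: prodD_ext => n; rewrite /prodD_mul /headD /y ltnS.
  case: ltngtP => _; first by rewrite [RHS]mulg1.
    by rewrite [RHS]mulg1.
  by rewrite [RHS]mul1g.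
rewrite prodD_permM; apply: (subgroupM gT) => //.
have -> : prodD_perm y = zinterval (Posz (k N)) (sgval (x N)).
  apply: zperm_ext => z /=.
  have [z0|[n [j zE]]] := blocks_case k_inc z.
    rewrite blocks_fun_out // interval_fun_out //.
    by have := leq_k k_inc (leq0n N); lia.
  rewrite zE blocks_fun_in /y; have [nN|nN] := eqVneq n N.
    by subst n; rewrite interval_fun_in.
  rewrite perm1 interval_fun_out //; have := ltn_ord j.
  case: (ltngtP n N) nN => // nN _.
    by have := leq_k k_inc nN; lia.
  by have := leq_k k_inc nN; lia.
by apply: zinterval_alt; apply: (fintype.subsetP (D_alt N)); exact: subgP.
Qed.

(** The products of an element of [alt_on setT] and an element of the product of
    the [D n] form a subgroup, because [alt_on setT] is normalised by all
    permutations. *)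
Lemma alt_prod_decomp (g : zperm) : g \in alt_prod_set k_inc D ->
  exists f x, alt_on setT f /\ g = f * prodD_perm x.
Proof.
have gT := alt_on_group setT; have [T1 _ _] := gT.
move=> /set_mem gS.
apply: (gS [set g | exists f x, alt_on setT f /\ g = f * prodD_perm x]).
split; last first.
  move=> f [/alt_finZ_alt fA|[x _ <-]].
    by exists f, (prodD_one D); rewrite prodD_perm_one mulg1.
  by exists 1, x; rewrite mul1g.
split.
- by exists 1, (prodD_one D); rewrite prodD_perm_one mulg1.
- move=> _ _ [f [x [fA ->]]] [g' [y [gA ->]]].
  exists (f * g' ^ (prodD_perm x)^-1), (prodD_mul x y); split.
    by apply: (subgroupM gT) => //; exact: alt_onJ.
  by rewrite prodD_permM conjgE invgK !mulgA mulgVK.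
move=> _ [f [x [fA ->]]]; exists ((f^-1) ^ prodD_perm x), (prodD_inv x); split.
  by apply: alt_onJ; exact: (subgroupV gT).
have -> : prodD_perm (prodD_inv x) = (prodD_perm x)^-1.
  by apply/esym/mulg1_eq; rewrite -prodD_permM prodD_mulV prodD_perm_one.
by rewrite invgM conjgE !mulgA mulgK.
Qed.

(** [alt_on setT] is dense: it contains the first factors of any element of the
    product of the [D n]. *)
Lemma alt_prod_decomp_tail (g : zperm) N : g \in alt_prod_set k_inc D ->
  exists f x, [/\ alt_on setT f, tailD N x & g = f * prodD_perm x].
Proof.
move=> /alt_prod_decomp[f [x [fA ->]]].
have [t tN xE] := headDK N x.
exists (f * prodD_perm (headD N x)), t; split => //.
  by apply: (subgroupM (alt_on_group _)) => //; exact: headD_alt.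
by rewrite {1}xE prodD_permM mulgA.
Qed.

End decomposition.

(** * Isolating a moved point *)

(** [K] is cut into [r] blocks of [m] points; each block supports a nontrivial
    element of [L], and [P] consists of one point moved by each of them. *)
Lemma separated_points (L : set zperm) (A : set int) m r (K : seq int) :
    (forall J : seq int, uniq J -> size J = m -> [set` J] `<=` A ->
      exists a, [/\ L a, a <> 1 & supported [set` J] a]) ->
    uniq K -> size K = (r * m)%N -> [set` K] `<=` A ->
  exists P : seq int, [/\ uniq P, size P = r, [set` P] `<=` [set` K] &
    forall p, p \in P -> exists a, [/\ L a, supported [set` K] a, a p <> p &
      forall q, q \in P -> q <> p -> a q = q]].
Proof.
move=> LA; elim: r K => [|r IHr] K uK sK KA; first by exists [::].
have KE : K = take m K ++ drop m K by rewrite cat_take_drop.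
have mK : (m <= size K)%N by rewrite sK leq_pmull.
move: uK; rewrite {1}KE cat_uniq => /and3P[uT dTD uD].
have TK : [set` take m K] `<=` [set` K] by move=> z; exact: mem_take.
have DK : [set` drop m K] `<=` [set` K] by move=> z; exact: mem_drop.
have [b [Lb b1 bT]] := LA _ uT (size_takel mK) (subset_trans TK KA).
have [|P [uP sP PD Pb]] := IHr _ uD _ (subset_trans DK KA).
  by rewrite size_drop sK mulSn addKn.
have [p bp] := moved_point b1.
have pT : p \in take m K := supported_moved bT bp.
have TD z : z \in take m K -> z \in drop m K -> False.
  by move=> zT zD; move/hasPn: dTD => /(_ _ zD) /=; rewrite zT.
exists (p :: P); split.
- by rewrite /= uP andbT; apply/negP => /PD; exact: TD.
- by rewrite /= sP.
- by move=> z; rewrite /= inE => /orP[/eqP->|/PD]; [exact: TK|exact: DK].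
move=> q; rewrite inE => /orP[/eqP->|qP].
  exists b; split=> //; first exact: supportedS bT.
  move=> z; rewrite inE => /orP[/eqP//|/PD zD _]; apply: bT => zT.
  exact: TD zT zD.
have [a [La aD aq aP]] := Pb q qP; exists a; split=> //.
  exact: supportedS aD.
move=> z; rewrite inE => /orP[/eqP-> _|]; last exact: aP.
by apply: aD => /(TD _ pT).
Qed.

(** * Subgroups up to the tail of the product *)

Section level.
Context (k : nat -> nat) (k_inc : {homo k : m n / (m < n)%N}).
Context (D : forall n, {group 'S_(k n.+1 - k n)}).
Local Notation prodD_perm := (@prodD_perm k k_inc D).
Local Notation below M := (zbelow (Posz (k M))).

Lemma tail_commute M f (t : prodD D) : supported (below M) f -> tailD M t ->
  f * prodD_perm t = prodD_perm t * f.
Proof.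
move=> fM tM; apply: (supported_commute (B := ~` below M) _ fM).
  by rewrite setICr.
by move=> z /contrapT zM; exact: (prodD_perm_fix k_inc tM).
Qed.

(** Since the tail commutes with the permutations supported below [k M], this is
    a subgroup when [H] is ([level_group]). *)
Definition level (H : set zperm) M : set zperm :=
  [set f | supported (below M) f /\
    exists2 t : prodD D, tailD M t & H (f * prodD_perm t)].

Lemma level_group H M : is_subgroup H -> is_subgroup (level H M).
Proof.
move=> gH; have [H1 HM HV] := gH; have gS := supported_group (below M).
split=> [|f g [fM [t tM Hft]] [gM [u uM Hgu]]|f [fM [t tM Hft]]].
- split; first by case: gS.
  by exists (prodD_one D) => //; rewrite prodD_perm_one mulg1.
- split; first exact: (subgroupM gS).
  exists (prodD_mul t u); first exact: tailDM.
  have := HM _ _ Hft Hgu; rewrite prodD_permM !mulgA.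
  by rewrite -(mulgA f) -(tail_commute gM tM) !mulgA.
split; first exact: (subgroupV gS).
exists (prodD_inv t); first exact: tailDV.
have := HV _ Hft; rewrite invgM.
have -> : (prodD_perm t)^-1 = prodD_perm (prodD_inv t).
  by apply: mulg1_eq; rewrite -prodD_permM prodD_mulV prodD_perm_one.
by rewrite (tail_commute (subgroupV gS fM) (tailDV tM)).
Qed.

Definition window (N : nat) : seq int :=
  [seq (Posz i - Posz N)%R | i <- iota 0 (N + k N)].

Lemma mem_window N z : (z \in window N) = (- Posz N <= z < Posz (k N))%R.
Proof.
apply/mapP/idP => [[i + ->]|zN]; first by rewrite mem_iota; lia.
by exists `|(z + Posz N)%R|%N; [rewrite mem_iota; lia|lia].
Qed.

Lemma window_uniq N : uniq (window N).
Proof. by rewrite map_inj_uniq ?iota_uniq // => i j; lia. Qed.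

Lemma size_window N : size (window N) = (N + k N)%N.
Proof. by rewrite size_map size_iota. Qed.

(** For large [N], all the elements of a given compact set that avoids [1] are of
    this form: see [visible_near]. *)
Definition visible (N : nat) (c : zperm) : Prop :=
  exists a (d : prodD D), [/\ c = a * prodD_perm d, a <> 1,
    supported [set` window N] a & tailD N d].

Section visible_conjugates.
Context (H : set zperm) (gH : is_subgroup H) (N : nat).
Hypothesis H_visible :
  forall g, alt_on setT g -> exists2 h, H h & visible N (h ^ g).
Let m := (N + k N)%N.

(** Conjugating by a permutation that carries [L] to the blocks [N, ..., M - 1]
    moves the action of [H] on these blocks over to [L]. *)
Lemma visible_moved M (P L : seq int) : (N <= M)%N -> uniq (P ++ L) ->
    [set` P ++ L] `<=` below N -> size P = m -> size L = (k M - k N)%N ->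
  exists a e (t : prodD D), [/\ a <> 1, supported [set` P] a,
    supported [set` L] e, tailD M t & H (a * e * prodD_perm t)].
Proof.
move=> NM uPL PLN sP sL; have kNM := leq_k k_inc NM.
pose R := [seq Posz i | i <- iota (k N) (k M - k N)].
have mem_R z : (z \in R) = (Posz (k N) <= z < Posz (k M))%R.
  apply/mapP/idP => [[i + ->]|zN]; first by rewrite mem_iota; lia.
  by exists `|z|%N; [rewrite mem_iota; lia|lia].
have uWR : uniq (window N ++ R).
  rewrite cat_uniq window_uniq map_inj_uniq ?iota_uniq; last by move=> i j [].
  rewrite andbT /=; apply/hasPn => z; rewrite mem_R /= mem_window; lia.
have sWR : size (P ++ L) = size (window N ++ R).
  by rewrite !size_cat size_window sP sL !size_map size_iota.
have [z /PLN /=|z /=|g gM gPL] := alt_on_transitive (b := Posz (k M)) uPL uWR sWR.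
- by rewrite /zbelow /=; lia.
- by rewrite mem_cat mem_window mem_R /zbelow /=; lia.
have [gP gL] : map g P = window N /\ map g L = R.
  move/eqP: gPL; rewrite map_cat eqseq_cat; last by rewrite size_map size_window.
  by move=> /andP[/eqP ? /eqP ?].
have [h Hh [a [d [hE a1 aW dN]]]] := H_visible (alt_onS (@subsetT _ _) gM).
have [t tM dE] := headDK M d.
exists (a ^ g^-1), ((prodD_perm (headD M d)) ^ g^-1), t; split=> //.
- by move/eqP; rewrite conjg_eq1 => /eqP.
- apply: supported_conj aW => z /=.
  by rewrite -gP (mem_map (@zperm_inj g)).
- apply: (@supported_conj [set` R]) => [z /=|].
    by rewrite -gL (mem_map (@zperm_inj g)).
  move=> z /= /negP; rewrite mem_R negb_and -!Order.TotalTheory.ltNge.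
  move=> /orP[zN|Mz].
    apply: (@prodD_perm_fix _ k_inc _ N) => // n nN.
    by rewrite /headD dN //; case: ifP.
  by apply: headD_perm_fix; rewrite Order.TotalTheory.leNgt.
have -> : prodD_perm t = prodD_perm t ^ g^-1.
  rewrite conjgE invgK -(tail_commute _ tM) ?mulVKg //.
  exact: (subgroupV (supported_group _) (alt_on_supported gM)).
by rewrite -!conjMg -mulgA -prodD_permM -dE -hE conjgK.
Qed.

Lemma visible_level (K : seq int) : uniq K -> size K = m ->
    [set` K] `<=` below N ->
  exists a, [/\ level H N a, a <> 1 & supported [set` K] a].
Proof.
move=> uK sK KN.
have [||||a [e [t [a1 aK eL tN Haet]]]] := @visible_moved N K [::] (leqnn N).
- by rewrite cats0.
- by rewrite cats0.
- exact: sK.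
- by rewrite subnn.
have e1 : e = 1 by apply: zperm_ext => z; exact: eL.
exists a; split=> //; split; first exact: supportedS aK.
by exists t => //; move: Haet; rewrite e1 mulg1.
Qed.

(** The actions on the blocks [N, ..., M - 1] disappear from the commutator of
    an element of [level H N] and an element provided by [visible_moved]. *)
Lemma visible_cycle3 M (Y : seq int) : (N <= M)%N -> uniq Y ->
    size Y = (m * m)%N -> [set` Y] `<=` below N ->
  exists x y z, [/\ uniq [:: x; y; z], {subset [:: x; y; z] <= Y} &
    level H M (cycle3 x y z)].
Proof.
move=> NM uY sY YN; have kNM := leq_k k_inc NM.
have [P [uP sP PY Pb]] := separated_points visible_level uY sY YN.
have [L [uL sL LN LY]] := exists_fresh (Posz (k N)) (k M - k N) Y.
have PN : [set` P] `<=` below N by exact: subset_trans YN.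
have [||||a [e [t [a1 aP eL tM Haet]]]] := @visible_moved M P L NM.
- rewrite cat_uniq uP uL andbT /=; apply/hasPn => z /LY.
  by apply: contra => /PY.
- by move=> z; rewrite /= mem_cat => /orP[/PN|/LN].
- exact: sP.
- exact: sL.
have [p ap] := moved_point a1.
have pP : p \in P := supported_moved aP ap.
have [b [[bN [d dN Hbd]] bY bp bP]] := Pb p pP.
have [t' t'M dE] := headDK M d.
pose h := prodD_perm (headD M d).
have NMbelow : below N `<=` below M by move=> z; rewrite /zbelow /=; lia.
have hR : supported (below M `\` below N) h.
  move=> z /not_andP[Mz|/contrapT zN].
    by apply: headD_perm_fix; move: Mz; rewrite /zbelow /=; lia.
  apply: (@prodD_perm_fix _ k_inc _ N) => // n nN.
  by rewrite /headD dN //; case: ifP.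
have aN : supported (below N) a by exact: supportedS aP.
have eN : supported (below N) e by exact: supportedS eL.
have gM := supported_group (below M).
have hN f : supported (below N) f -> f * h = h * f.
  by move=> fN; apply: (supported_commute _ fN hR); rewrite -subset0 => z [? []].
have be : b * e = e * b.
  apply: (supported_commute _ bY eL); rewrite -subset0 => z [/= zY zL].
  by move: (LY z zL); rewrite zY.
have Lbh : level H M (b * h).
  split; last by exists t' => //; rewrite -mulgA -prodD_permM -dE.
  by apply: (subgroupM gM); [exact: supportedS bN|exact: supportedS hR].
have Lae : level H M (a * e).
  split; last by exists t.
  by apply: (subgroupM gM); [exact: supportedS aN|exact: supportedS eN].
have gL := level_group M gH.
have := subgroupM gL (subgroupM gL Lbh Lae)
  (subgroupV gL (subgroupM gL Lae Lbh)).
have -> : b * h * (a * e) * (a * e * (b * h))^-1 = b * a * b^-1 * a^-1.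
  have -> : b * h * (a * e) = (b * a) * (h * e).
    by rewrite !mulgA -(mulgA b h) -(hN a aN) !mulgA.
  have -> : a * e * (b * h) = (a * b) * (h * e).
    by rewrite !mulgA -(mulgA a e) -be !mulgA -[_ * e * h]mulgA (hN e eN) !mulgA.
  by rewrite [(_ * (h * e))^-1]invgM mulgA mulgK invgM mulgA.
have [z zp bz|u3 ->] := commutator_cycle3 bp ap.
  apply: contrapT => az; apply: bz; apply: bP => //.
  exact: supported_moved aP az.
exists ((b^-1)%g p), p, ((a^-1)%g p); split=> // z; rewrite !inE.
have bVp : (b^-1)%g p \in Y.
  exact: (supported_mem (subgroupV (supported_group _) bY) (PY p pP)).
have aVp : (a^-1)%g p \in Y.
  by apply: PY; exact: (supported_mem (subgroupV (supported_group _) aP) pP).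
by move=> /or3P[] /eqP-> //; exact: PY.
Qed.

(** There are enough points below [k N] for some class of points related by
    [level H M] to have [r.+1] elements. *)
Lemma visible_clique M r : (N <= M)%N ->
  exists E : seq int, [/\ uniq E, size E = r.+1, [set` E] `<=` below N &
    forall x y z, uniq [:: x; y; z] -> {subset [:: x; y; z] <= E} ->
      level H M (cycle3 x y z)].
Proof.
move=> NM.
have [Y [uY sY YN _]] := exists_fresh (Posz (k N)) (m * m * r.+1) [::].
have [||E [uE sE EY E3]] := @cycle3_clique _ (m * m)%N r Y (level_group M gH) uY.
- by rewrite sY.
- move=> Z uZ sZ ZY; apply: visible_cycle3 => // z /ZY; exact: YN.
by exists E; split=> // z /EY; exact: YN.
Qed.

(** A conjugation moves a large clique of three-cycles onto the ball. *)
Lemma visible_alt M n : (N <= M)%N -> (n < M)%N ->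
  exists2 g, alt_on (below M) g & forall f, alt_on (zball n) f ->
    exists (t : prodD D) h, [/\ tailD M t, H h & h ^ g = f * prodD_perm t].
Proof.
move=> NM nM; have [E [uE sE EN E3]] := visible_clique (n + n)%N NM.
pose F := [seq (Posz i - Posz n)%R | i <- iota 0 (n + n).+1].
have mem_F z : (z \in F) = (- Posz n <= z <= Posz n)%R.
  apply/mapP/idP => [[i + ->]|zN]; first by rewrite mem_iota; lia.
  by exists `|(z + Posz n)%R|%N; [rewrite mem_iota; lia|lia].
have uF : uniq F by rewrite map_inj_uniq ?iota_uniq // => i j; lia.
have kNM := leq_k k_inc NM; have kM := geq_k k_inc M.
have sEF : size E = size F by rewrite sE size_map size_iota.
have [z /EN /=|z /=|g gM gE] := alt_on_transitive (b := Posz (k M)) uE uF sEF.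
- by rewrite /zbelow /=; lia.
- by rewrite mem_F /zbelow /=; lia.
exists g => //.
have gL := level_group M gH.
have sub : alt_on (zball n) `<=` [set f | level H M (f ^ g^-1)].
  apply: alt_on_sub.
    split=> [|f1 f2 /= ? ?|f1 /= ?].
    - by rewrite /= conj1g; case: gL.
    - by rewrite conjMg; exact: (subgroupM gL).
    - by rewrite conjVg; exact: (subgroupV gL).
  move=> x y z u xn yn zn /=; rewrite cycle3J; apply: E3.
    by rewrite -(map_inj_uniq (@zperm_inj (g^-1)%g)) in u.
  have FE w : zball n w -> (g^-1)%g w \in E.
    move=> wn; rewrite -(mem_map (@zperm_inj g)) gE zpermKV mem_F.
    by move: wn; rewrite /zball /=; lia.
  by move=> w; rewrite !inE => /or3P[] /eqP->; exact: FE.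
move=> f /sub[_ [t tM Hft]]; exists t, (f ^ g^-1 * prodD_perm t); split=> //.
rewrite conjMg conjgKV; congr (_ * _).
by rewrite conjgE -(tail_commute (alt_on_supported gM) tM) mulKg.
Qed.

End visible_conjugates.
End level.

(** * The Chabauty topology *)

Section chabauty.
Context {G : lcGroupType}.
Implicit Types (H : closedSubgroup G) (X : set (closedSubgroup G)).

Lemma chabauty_subbase_open i :
  chabauty_index i -> open (@chabauty_subbase G i).
Proof.
move=> Di; exists [set @chabauty_subbase G i]; last by rewrite bigcup_set1.
move=> _ ->; exists [fset i]%fset; first by move=> j /fset1P ->; exact/mem_set.
apply/seteqP; split=> [H|H Hi j /fset1P -> //]; apply.
exact/fset1P.
Qed.

(** It suffices to test convergence on the subbase. *)
Lemma chabauty_cvg (F : nat -> closedSubgroup G) H :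
    (forall V, open V -> precompact V -> H `&` V !=set0 ->
      \forall n \near \oo, F n `&` V !=set0) ->
    (forall C, compact C -> H `&` C = set0 ->
      \forall n \near \oo, F n `&` C = set0) ->
  F @ \oo --> H.
Proof.
move=> FV FC A; rewrite nbhsE => -[_ [[B sB <-] [C BC CH]] sBA].
rewrite nbhs_filterE; apply: filterS sBA _.
apply: (@filterS _ _ _ C) => [K CK|]; first by exists C.
have [I sI CE] := sB _ BC; rewrite -CE; apply: filter_bigI => -[[] V] Ij.
  have /set_mem [oV cV] := sI _ Ij; apply: FV => //.
  by move: CH; rewrite -CE => /(_ _ Ij).
have /set_mem cV := sI _ Ij; apply: FC => //.
by move: CH; rewrite -CE => /(_ _ Ij).
Qed.

Lemma closed_cs_full : closed [set @cs_full G].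
Proof.
rewrite -[X in closed X]setCK; apply: open_closedC.
rewrite (_ : ~` _ = \bigcup_(x in [set: G]) chabauty_subbase (false, [set x])).
  by apply: bigcup_open => x _; apply: chabauty_subbase_open; exact: compact_set1.
apply/seteqP; split=> [H HG|H [x _ /= Hx HE]].
  have [x Hx] : exists x, ~ cs_set H x.
    apply: contrapT => /forallNP HT; apply: HG; apply: cs_inj.
    by apply/seteqP; split=> // x _; exact: contrapT.
  exists x => //; rewrite /chabauty_subbase /= -subset0 => y [Hy yx].
  by apply: Hx; rewrite -yx.
by move: Hx; rewrite HE /chabauty_subbase /= -subset0; apply; split.
Qed.

(** A subgroup that contains some [x <> 1] meets an open relatively compact set
    that avoids [1]. *)
Lemma closed_cs_triv : closed [set @cs_triv G].
Proof.
rewrite -[X in closed X]setCK; apply: open_closedC.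
pose P : set (set G) := [set V | [/\ open V, precompact V & ~ V 1]].
rewrite (_ : ~` _ = \bigcup_(V in P) chabauty_subbase (true, V)).
  by apply: bigcup_open => V [oV cV _]; exact: chabauty_subbase_open.
apply/seteqP; split=> [H H1|H [V [_ _ V1] /= HV HE]]; last first.
  by move: HV; rewrite HE /chabauty_subbase => -[_ [/= -> /V1]].
have [x [Hx x1]] : exists x, cs_set H x /\ x <> 1.
  apply: contrapT => /forallNP HT; apply: H1; apply: cs_inj.
  apply/seteqP; split=> [x Hx|_ ->]; last by case: (cs_subgroup H).
  by apply: contrapT => x1; apply: (HT x).
have [K + [cK clK]] := @lcgroup_locally_compact G x I.
rewrite withinET => xK; exists (K° `\` [set 1]); last first.
  by exists x; split.
split; last by move=> [_]; apply.
- by apply: openI; [exact: open_interior|apply: closed_openC; exact: triv_closed].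
- by exists K => // y [/interior_subset].
Qed.

Lemma URS_set1 H : closed [set H] -> (forall g, cs_conj H g = H) -> URS [set H].
Proof.
move=> cH HJ; split=> //; first by exists H.
  by move=> _ g -> /=; exact: HJ.
move=> Y [K YK] _ _ YH; apply/seteqP; split=> // _ ->.
by rewrite -(YH K YK).
Qed.

Lemma cs_conj_triv g : cs_conj (@cs_triv G) g = cs_triv.
Proof.
by apply: cs_inj; apply/seteqP; split=> [_ [x -> <-]|_ ->] /=;
  [rewrite conj1g|exists 1; rewrite ?conj1g].
Qed.

Lemma cs_conj_full g : cs_conj (@cs_full G) g = cs_full.
Proof.
apply: cs_inj; apply/seteqP; split=> // x _.
by exists (x ^ g^-1); rewrite ?conjgKV.
Qed.

Lemma URS_eq1 X H : URS X -> X H -> closed [set H] ->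
  (forall g, cs_conj H g = H) -> X = [set H].
Proof.
move=> [_ _ _ minX] XH cH HJ; symmetry; apply: minX => //.
- by exists H.
- by move=> _ g ->; exact: HJ.
- by move=> _ ->.
Qed.

End chabauty.

(** * Uniformly recurrent subgroups of the group *)

Section alt_prod_urs.
Context (k : nat -> nat) (k_inc : {homo k : m n / (m < n)%N}).
Context (D : forall n, {group 'S_(k n.+1 - k n)}).
Hypothesis D_alt : forall n, D n \subset 'Alt_('I_(k n.+1 - k n)).
Local Notation G := (alt_prod k_inc D).
Local Notation prodD_perm := (@prodD_perm k k_inc D).
Local Notation visible := (@visible k k_inc D).

(** Near a nontrivial [c], every element moves some [z] in the same way as [c],
    and the factors of index at least [N] cannot account for this motion once
    [z] and [c z] lie below [k N]. *)
Lemma visible_near (c : G) : c <> 1 ->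
  \forall c' \near c & N \near \oo, visible N (val c').
Proof.
move=> c1; have [f [x [fA cE]]] := alt_prod_decomp (valP c).
have [n fn] := alt_on_zball fA.
have [z cz] : exists z, (val c : zperm) z <> z.
  by apply: moved_point => vc; apply: c1; apply: val_inj; rewrite val1.
pose N0 := (n + `|z|%N + `|(val c : zperm) z|%N).+1.
exists ([set c * prodD_inc k_inc y | y in tailD N0], [set N | (N0 <= N)%N]).
  split; last by exists N0.
  by apply/nbhsGP; exists N0 => y yN; exists y.
move=> [_ N] [/= [y yN <-] /= NN].
have [t tN xyE] := headDK N (prodD_mul x y).
have kN := geq_k k_inc N; have kN0 := geq_k k_inc N0.
have ltk (w : int) m M : (`|w| < m)%N -> (m <= M)%N -> (w < Posz M)%R by lia.
have [nN0 zN0 czN0] : [/\ (n < N0)%N, (`|z| < N0)%N & (`|(val c : zperm) z| < N0)%N].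
  by rewrite /N0; split; lia.
move: N0 nN0 zN0 czN0 NN kN0 yN => N0 nN0 zN0 czN0 NN kN0 yN.
pose a := f * prodD_perm (headD N (prodD_mul x y)).
have vE : val (c * prodD_inc k_inc y) = a * prodD_perm t.
  rewrite valM /= [X in X * _]cE -mulgA -prodD_permM.
  by rewrite {1}xyE prodD_permM mulgA.
exists a, t; split=> //.
  move=> a1; apply: cz.
  have := congr1 (fun s : zperm => s z) vE; rewrite a1 mul1g valM zpermM.
  rewrite (prodD_perm_fix k_inc tN); last by lia.
  by rewrite (prodD_perm_fix k_inc yN) //; exact: ltk czN0 kN0.
apply: (subgroupM (supported_group _)).
  apply: supportedS (alt_on_supported fn) => w.
  by rewrite /zball /= mem_window; lia.
move=> w /= /negP; rewrite mem_window negb_and -!Order.TotalTheory.ltNge.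
move=> /orP[wN|]; last by rewrite -Order.TotalTheory.leNgt; exact: headD_perm_fix.
by rewrite /= blocks_fun_out //; lia.
Qed.

Lemma alt_prod_valV (x : G) : val x^-1 = (val x : zperm)^-1.
Proof. by apply/esym/mulg1_eq; rewrite -valM mulgV val1. Qed.

Lemma alt_prod_valJ (x g : G) : val (x ^ g) = (val x : zperm) ^ val g.
Proof. by rewrite !conjgE !valM alt_prod_valV. Qed.

Definition cs_perms (H : closedSubgroup G) : set zperm :=
  [set val h | h in cs_set H].

Lemma cs_perms_group H : is_subgroup (cs_perms H).
Proof.
have [H1 HM HV] := cs_subgroup H; split.
- by exists 1; rewrite ?val1.
- by move=> _ _ [x Hx <-] [y Hy <-]; exists (x * y); rewrite ?valM //; exact: HM.
- by move=> _ [x Hx <-]; exists x^-1; rewrite ?alt_prod_valV //; exact: HV.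
Qed.

(** Otherwise [X] contains, for every [N], a subgroup without elements that are
    visible at [N].  By [visible_near] these subgroups eventually avoid any
    compact set that avoids [1], so they converge to [{1}]. *)
Lemma nontrivial_visible (X : set (closedSubgroup G)) :
    closed X -> ~ X cs_triv ->
  exists N, forall H, X H -> exists2 h, cs_perms H h & visible N h.
Proof.
move=> cX X1; apply: contrapT => /forallNP noN; apply: X1.
have {}noN N : exists H, X H /\ forall h, cs_set H h -> ~ visible N (val h).
  apply: contrapT => /forallNP noH; apply: (noN N) => H XH.
  apply: contrapT => noh; apply: (noH H); split=> // h Hh hN.
  by apply: noh; exists (val h) => //; exists h.
have [F FP] := choice noN.
apply: (closed_cvg X cX) (chabauty_cvg _ _ : F @ \oo --> cs_triv).
- by apply: nearW => n; case: (FP n).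
- move=> V _ _ [_ [-> V1]]; apply: nearW => n; exists 1; split=> //.
  by case: (cs_subgroup (F n)).
move=> C /compact_near_coveringP cC C1.
have [n0 _ Cn] : \forall N \near \oo, C `<=` (fun c => visible N (val c)).
  apply: (cC nat \oo (fun N c => visible N (val c))) => c Cc.
  apply: visible_near => c1; move: Cc; rewrite c1 => C1'.
  by rewrite -[False]/((set0 : set G) 1) -C1.
exists n0 => // n nn; rewrite -subset0 => h [Fh Ch].
by case: (FP n) => _ /(_ h Fh); apply; exact: Cn.
Qed.

(** The conjugates provided by [visible_alt] for larger and larger balls and
    smaller and smaller tails eventually meet every nonempty open set, because
    the finitely supported even permutations are dense. *)
Lemma visible_cvg_full (H : closedSubgroup G) N :
    (forall g, exists2 h, cs_perms (cs_conj H g) h & visible N h) ->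
  exists F : nat -> G, (fun n => cs_conj H (F n)) @ \oo --> cs_full.
Proof.
move=> HN.
have Hvis g : alt_on setT g -> exists2 h, cs_perms H h & visible N (h ^ g).
  move=> /(alt_on_alt_prod k_inc D) gG.
  have [_ [_ [h Hh <-] <-] hN] := HN (Sub g gG).
  exists (val h); first by exists h.
  by move: hN; rewrite alt_prod_valJ SubK.
have approx n : exists g : G, forall f, alt_on (zball n) f ->
    exists (t : prodD D) (h : G), [/\ tailD n t, cs_set H h &
      val (h ^ g) = f * prodD_perm t].
  have [||g gM gP] := visible_alt (cs_perms_group H) Hvis (M := (N + n).+1) (n := n).
  - by lia.
  - by lia.
  have gG : g \in alt_prod_set k_inc D.
    by apply: alt_on_alt_prod; apply: alt_onS gM; exact: subsetT.
  exists (Sub g gG) => f /gP[t [_ [tM [h Hh <-] hE]]]; exists t, h; split=> //.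
  by apply: tailDW tM; lia.
have [F FP] := choice approx; exists F; apply: chabauty_cvg => [V|C cC]; last first.
  by rewrite /= setTI => ->; apply: nearW => n; rewrite setI0.
move=> /openGP oV _ [v [_ Vv]]; have [N0 NV] := oV v Vv.
have [f [x [fA xN vE]]] := alt_prod_decomp_tail D_alt N0 (valP v).
have [n0 fn0] := alt_on_zball fA.
exists (maxn n0 N0) => // n; rewrite /= geq_max => /andP[n0n N0n].
have fn : alt_on (zball n) f.
  by apply: alt_onS fn0 => z /leq_trans; apply.
have [t [h [tn Hh hE]]] := FP n f fn.
exists (h ^ F n); split; first by exists h.
have -> : h ^ F n = v * prodD_inc k_inc (prodD_mul (prodD_inv x) t).
  apply: val_inj; rewrite hE valM [X in _ = X * _]vE /= -mulgA -prodD_permM.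
  by rewrite prodD_mulVK.
by apply: NV; apply: tailDM; [exact: tailDV|exact: tailDW tn].
Qed.

Lemma alt_prod_URS : no_nontrivial_URS G.
Proof.
move=> X; split=> [uX|[]->]; last first.
- by apply: URS_set1; [exact: closed_cs_full|exact: cs_conj_full].
- by apply: URS_set1; [exact: closed_cs_triv|exact: cs_conj_triv].
have [X1|X1] := pselect (X cs_triv).
  by left; apply: URS_eq1 => //; [exact: closed_cs_triv|exact: cs_conj_triv].
have [[H XH] cX JX _] := uX.
have [N XN] := nontrivial_visible cX X1.
have [F FH] := @visible_cvg_full H N (fun g => XN _ (JX H g XH)).
right; apply: URS_eq1 => //; [|exact: closed_cs_full|exact: cs_conj_full].
by apply: (closed_cvg X cX) FH; apply: nearW => n; exact: JX.
Qed.

End alt_prod_urs.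

(** * Subgroups of finite index *)

Section finite_index.
Context (L : set zperm) (gL : is_subgroup L) (b : int) (T : seq zperm).
Hypothesis LT : forall g, alt_on (zbelow b) g ->
  exists2 t, t \in T & L (t^-1 * g).

(** The index [i] is coloured by the cosets of both [g i] and [h i]. *)
Lemma finite_index_pigeonhole (g h : nat -> zperm) :
    (forall i, alt_on (zbelow b) (g i)) -> (forall i, alt_on (zbelow b) (h i)) ->
  exists i j, [/\ (i < j)%N, (j < (size T * size T).+1)%N,
    L ((g i)^-1 * g j) & L ((h i)^-1 * h j)].
Proof.
move=> gA hA; pose n := size T.
have col u : exists c, alt_on (zbelow b) u -> (c < n)%N /\ L ((nth 1 T c)^-1 * u).
  have [uA|uA] := pselect (alt_on (zbelow b) u); last by exists 0%N.
  by have [t tT Ltu] := LT uA; exists (index t T); rewrite index_mem nth_index.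
have {col}[c cP] := choice col.
have cL u v : alt_on (zbelow b) u -> alt_on (zbelow b) v -> c u = c v ->
    L (u^-1 * v).
  move=> /cP[_ Lu] /cP[_ Lv] cuv.
  have := subgroupM gL (subgroupV gL Lu) Lv.
  by rewrite cuv invgM invgK -!mulgA mulVKg.
pose s := [seq (c (g i), c (h i)) | i <- iota 0 (n * n).+1].
pose s' := [seq (i, j) | i <- iota 0 n, j <- iota 0 n].
have : ~~ uniq s.
  apply/negP => us; have : (size s <= size s')%N.
    apply: uniq_leq_size us _ => _ /mapP[i _ ->].
    have [[cg _] [ch _]] := (cP _ (gA i), cP _ (hA i)).
    by apply: allpairs_f; rewrite mem_iota.
  by rewrite size_map size_allpairs !size_iota ltnn.
move=> /(uniqPn (0%N, 0%N))[i [j [ij]]]; rewrite size_map size_iota => jn.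
rewrite !(nth_map 0%N) ?size_iota ?(ltn_trans ij) // !nth_iota ?(ltn_trans ij) //.
move=> [/cL Lg /cL Lh]; exists i, j; split=> //; [exact: Lg|exact: Lh].
Qed.

(** Take [t0 = (y -> x -> z -> y)] and the three-cycles [x -> a i -> c i -> x]
    for disjoint pairs of points [a i], [c i].  The pigeonhole principle, applied
    to the cosets of these cycles and of their products with [t0^-1], gives an
    [s] in [L] that moves [x], fixes [y] and [z], and whose conjugate by [t0^-1]
    is in [L]; then [s * t0 * s^-1 * t0^-1] is a three-cycle through [x] and [y]. *)
Lemma finite_index_related x y : (x < b)%R -> (y < b)%R -> related L x y.
Proof.
move=> xb yb; have [->|/eqP xy] := eqVneq x y; first by left.
right; pose n := (size T * size T).+1.
have [F [uF sF Fb Fxy]] := exists_fresh b (n + n).+1 [:: x; y].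
pose pt i := nth 0%R F i.
have ptF i : (i < (n + n).+1)%N -> pt i \in F by move=> iF; rewrite mem_nth ?sF.
have ptb i : (i < (n + n).+1)%N -> zbelow b (pt i) by move/ptF; exact: Fb.
have ptx i : (i < (n + n).+1)%N -> pt i <> x.
  by move/ptF/Fxy; rewrite !inE negb_or => /andP[/eqP].
have pty i : (i < (n + n).+1)%N -> pt i <> y.
  by move/ptF/Fxy; rewrite !inE negb_or => /andP[_ /eqP].
have ptI i j : (i < (n + n).+1)%N -> (j < (n + n).+1)%N -> i <> j -> pt i <> pt j.
  by move=> iF jF ij /eqP; rewrite nth_uniq ?sF // => /eqP.
pose z := pt (n + n)%N.
have zb : zbelow b z by apply: ptb.
have zx : z <> x by apply: ptx.
have zy : z <> y by apply: pty.
pose t0 := cycle3 y x z.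
have ut0 : uniq [:: y; x; z] by apply/uniq3P; split=> //; exact/nesym.
(* Indices are truncated so that [a], [c] and [g] make sense for every [i]. *)
pose m i := if (i < n)%N then i else 0%N.
have mn i : (m i < n)%N by rewrite /m; case: ifP.
pose a i := pt (m i); pose c i := pt (n + m i)%N.
have uac i : uniq [:: x; a i; c i].
  have := mn i => min; apply/uniq3P; split.
  - by apply/nesym/ptx; lia.
  - by apply/nesym/ptx; lia.
  - by apply: ptI; lia.
pose g i := cycle3 x (a i) (c i).
have gA := alt_on_group (zbelow b).
have gb i : alt_on (zbelow b) (g i).
  have := mn i => min; apply: alt_on_cycle3 => //; apply: ptb; lia.
have t0b : alt_on (zbelow b) t0 by exact: alt_on_cycle3.
have [i [j [ij jn Ls Lst]]] := finite_index_pigeonhole gb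
  (fun i => subgroupM gA (gb i) (subgroupV gA t0b)).
have mi : m i = i by rewrite /m (ltn_trans ij jn).
have mj : m j = j by rewrite /m jn.
have [s sE] : exists s, s = (g i)^-1 * g j by exists ((g i)^-1 * g j).
rewrite -sE in Ls.
have {Lst}Lst : L (s * t0 * s^-1 * t0^-1).
  have -> : s * t0 * s^-1 * t0^-1 = s * (t0 * s * t0^-1)^-1.
    by rewrite invgF [(t0 * s)^-1]invgM !mulgA.
  apply: (subgroupM gL) => //; apply: (subgroupV gL).
  by move: Lst; rewrite sE invgF !mulgA.
have sx : s x = c i.
  rewrite sE zpermM /g cycle3V cycle3_1; last first.
    by apply/uniq3P; case/uniq3P: (uac i) => ? ? ?; split=> //; exact/nesym.
  rewrite cycle3_out // !inE; apply/negP => /or3P[] /eqP; rewrite /c /a mi ?mj.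
  - by apply: ptx; lia.
  - by apply: ptI; lia.
  - by apply: ptI; lia.
have t0x : t0 x = z by exact: cycle3_2.
have t0y : (t0^-1)%g x = y by rewrite -[in LHS](cycle3_1 ut0) zpermK.
have sfix w : w <> x -> s w <> w -> t0 w = w.
  move=> wx sw; apply: cycle3_out; rewrite !inE; apply/negP => wt.
  have sS : supported [set` [:: x; a i; c i; a j; c j]] s.
    rewrite sE; apply: (subgroupM (supported_group _)).
      by apply: (subgroupV (supported_group _));
        apply: supported_cycle3; rewrite /= !inE eqxx ?orbT.
    by apply: supported_cycle3; rewrite /= !inE eqxx ?orbT.
  have := supported_moved sS sw; rewrite /= !inE => ws.
  have {ws}[l ln wl] : exists2 l, (l < n + n)%N & w = pt l.
    case/or3P: ws wx => [/eqP-> //|/eqP-> _|].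
      by exists (m i) => //; have := mn i; lia.
    case/or3P => /eqP-> _.
    - by exists (n + m i)%N => //; have := mn i; lia.
    - by exists (m j) => //; have := mn j; lia.
    - by exists (n + m j)%N => //; have := mn j; lia.
  case/or3P: wt => /eqP; rewrite wl.
  - by apply: pty; lia.
  - by apply: ptx; lia.
  - by apply: ptI; lia.
have [||u3 com] := @commutator_cycle3 s t0 x _ _ sfix.
- by rewrite sx; apply: ptx; have := mn i; lia.
- by rewrite t0x.
move: u3 com; rewrite t0y; set u := (s^-1)%g x => u3 com.
exists u; first by rewrite -(rot_uniq 1) in u3.
by rewrite -(cycle3_rot u3) -com.
Qed.

Lemma finite_index_alt : alt_on (zbelow b) `<=` L.
Proof.
apply: alt_on_sub => // x y z u xb yb zb.
by apply: related_cycle3 => //; exact: finite_index_related.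
Qed.

End finite_index.

(** * Subgroups of finite covolume *)

(** Words in the three-cycles show that [alt_on setT] is countable. *)
Definition cycle3_word (l : seq (int * int * int)) : zperm :=
  foldr (fun w f => cycle3 w.1.1 w.1.2 w.2 * f) 1 l.

Lemma alt_on_cycle3_word : alt_on setT `<=` range cycle3_word.
Proof.
have wM l l' : cycle3_word (l ++ l') = cycle3_word l * cycle3_word l'.
  by elim: l => [|w l IHl] /=; rewrite ?mul1g // IHl mulgA.
apply: alt_on_sub => [|x y z _ _ _ _]; last first.
  by exists [:: (x, y, z)] => //=; rewrite mulg1.
split=> [|_ _ [l _ <-] [l' _ <-]|_ [l _ <-]]; first by exists [::].
  by exists (l ++ l').
elim: l => [|w l [l' _ IHl]] /=; first by exists [::]; rewrite ?invg1.
exists (l' ++ [:: (w.1.1, w.2, w.1.2)]) => //.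
by rewrite wM IHl /= mulg1 invgM cycle3V.
Qed.

Section finite_covolume.
Context (R : realType).
Context (k : nat -> nat) (k_inc : {homo k : m n / (m < n)%N}).
Context (D : forall n, {group 'S_(k n.+1 - k n)}).
Hypothesis D_alt : forall n, D n \subset 'Alt_('I_(k n.+1 - k n)).
Local Notation G := (alt_prod k_inc D).
Local Notation prodD_perm := (@prodD_perm k k_inc D).
Local Notation inc := (@prodD_inc k k_inc D).
Context (H : closedSubgroup G).
Local Notation "[ 'cs' x ]" := (\pi_(coset_space H)%qT x) (at level 0).

Definition tail_cosets M (g : G) : set (coset_space H) :=
  [set c | exists2 y : prodD D, tailD M y & c = [cs g * inc y]].

Lemma cosets_eq (x y : G) : [cs x] = [cs y] <-> cs_set H (x^-1 * y).
Proof.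
split=> [/generic_quotient.eqmodP/asboolP //|Hxy].
by apply/generic_quotient.eqmodP/asboolP.
Qed.

Lemma cosets_repr (c : coset_space H) : exists x, c = [cs x].
Proof. by exists (generic_quotient.repr c); rewrite generic_quotient.reprK. Qed.

Lemma tail_cosetsE M g x : tail_cosets M g [cs x] <->
  exists2 y, tailD M y & cs_set H ((g * inc y)^-1 * x).
Proof.
by split=> -[y yM] => [/esym/cosets_eq|/cosets_eq/esym]; exists y.
Qed.

(** The product of the [D n], [n >= M], need not be normalised by [x^-1 * g], but
    a smaller tail is mapped into it. *)
Lemma tail_cosets_open M g : open (tail_cosets M g).
Proof.
rewrite /open /= /quotient_open; apply/openGP => x /= /tail_cosetsE[y yM Hyx].
have [N0 xN] := prodD_inc_conj (x^-1 * g).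
exists (maxn M N0) => t tN; apply/tail_cosetsE.
have [u uN tu] := xN _ _ (leq_maxr M N0) tN.
exists (prodD_mul u y).
  by apply: tailDM => //; apply: tailDW uN; exact: leq_maxl.
have -> : (g * inc (prodD_mul u y))^-1 * (x * inc t) = (g * inc y)^-1 * x => //.
apply: (@mulgI _ (g * inc (prodD_mul u y))); rewrite mulVKg.
apply: (@mulgI _ x^-1); rewrite mulKg prodD_incM.
have -> : x^-1 * (g * (inc u * inc y) * ((g * inc y)^-1 * x)) =
    x^-1 * g * inc u * (inc y * (g * inc y)^-1 * x) by rewrite !mulgA.
by rewrite -tu invgM !mulgA mulgK mulgK mulgVK.
Qed.

Lemma coset_act_tail_cosets M g :
  coset_act g @^-1` tail_cosets M g = tail_cosets M 1.
Proof.
apply/seteqP; split=> c; have [x ->] := cosets_repr c;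
  rewrite /preimage /= coset_actE => /tail_cosetsE[y yM Hy]; apply/tail_cosetsE;
  by exists y => //; move: Hy; rewrite !invgM invg1 mulg1 -!mulgA ?mulKg.
Qed.

(** Elements supported below [k M] commute with the product of the [D n],
    [n >= M], so that two translates meet only when the two elements lie in the
    same left coset of [level H M]. *)
Lemma tail_cosets_meet M (f g : G) c : supported (zbelow (Posz (k M))) (val f) ->
  supported (zbelow (Posz (k M))) (val g) ->
  tail_cosets M f c -> tail_cosets M g c ->
  level k_inc D (cs_perms H) M ((val f : zperm)^-1 * val g).
Proof.
have [x ->] := cosets_repr c => fM gM /tail_cosetsE[y yM Hy] /tail_cosetsE[z zM Hz].
have gS := supported_group (zbelow (Posz (k M))).
have fgM := subgroupM gS (subgroupV gS fM) gM.
split=> //; exists (prodD_mul (prodD_inv y) z).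
  by apply: tailDM => //; exact: tailDV.
have [_ HM HV] := cs_subgroup H.
exists ((inc y)^-1 * (f^-1 * g) * inc z).
  have -> : (inc y)^-1 * (f^-1 * g) * inc z =
    ((f * inc y)^-1 * x) * ((g * inc z)^-1 * x)^-1.
    by rewrite !invgM !invgK !mulgA mulgK.
  by apply: HM => //; exact: HV.
have -> : (inc y)^-1 = inc (prodD_inv y) by rewrite prodD_incV.
rewrite !valM alt_prod_valV prodD_permM [RHS]mulgA; congr (_ * _).
exact: (esym (tail_commute k_inc fgM (tailDV yM))).
Qed.

Lemma tail_cosets_cover M c : exists2 f : G,
  alt_on setT (val f) & tail_cosets M f c.
Proof.
have [x ->] := cosets_repr c.
have [f [y [fA yM xE]]] := alt_prod_decomp_tail D_alt M (valP x).
exists (Sub f (alt_on_alt_prod k_inc D fA)); first by rewrite SubK.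
exists y => //; congr (\pi_(_) _)%qT.
by apply: val_inj; rewrite valM SubK.
Qed.

Section measure.
Context (P : probability (g_sigma_algebraType (@open (coset_space H))) R).
Hypothesis P_inv : forall (g : G) (A : set (coset_space H)),
  (@open (coset_space H)).-sigma.-measurable A -> P (coset_act g @^-1` A) = P A.

Lemma tail_cosets_measurable M g :
  (@open (coset_space H)).-sigma.-measurable (tail_cosets M g).
Proof. by apply: sub_sigma_algebra; exact: tail_cosets_open. Qed.

Lemma tail_cosets_measure M g : P (tail_cosets M g) = P (tail_cosets M 1).
Proof.
by rewrite -(coset_act_tail_cosets M g) P_inv //; exact: tail_cosets_measurable.
Qed.

Local Open Scope ereal_scope.

(** Countably many translates cover [G/H], so they are not null sets. *)
Lemma tail_cosets_gt0 M : 0 < P (tail_cosets M 1%g).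
Proof.
rewrite lt0e measure_ge0 andbT; apply/eqP => P0.
pose e n : G := insubd (1%g : G) (cycle3_word (odflt [::] (choice.unpickle n))).
have : P.-negligible (\bigcup_n tail_cosets M (e n)).
  apply: negligible_bigcup => n; exists (tail_cosets M (e n)); split=> //.
    exact: tail_cosets_measurable.
  by rewrite -[RHS]P0; exact: tail_cosets_measure.
rewrite (_ : \bigcup_n _ = setT).
  move=> /(measure_negligible measurableT) PT.
  by have /eqP := etrans (esym (probability_setT P)) PT; rewrite onee_eq0.
apply/seteqP; split=> // c _; have [f fA fc] := tail_cosets_cover M c.
have [l _ lf] := alt_on_cycle3_word fA.
exists (choice.pickle l) => //; rewrite /e choice.pickleK /= lf.
by rewrite valKd.
Qed.

Lemma disjoint_tail_cosets M (s : seq G) : uniq s ->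
    (forall f g c, f \in s -> g \in s -> tail_cosets M f c ->
      tail_cosets M g c -> f = g) ->
  P [set c | exists2 f, f \in s & tail_cosets M f c] =
    (size s)%:R%:E * P (tail_cosets M 1%g).
Proof.
elim: s => [|f s IHs] us sI.
  rewrite mul0e (_ : [set c | _] = set0) ?measure0 //.
  by rewrite -subset0 => c [].
have mU (r : seq G) : (@open (coset_space H)).-sigma.-measurable
    [set c | exists2 f, f \in r & tail_cosets M f c].
  apply: sub_sigma_algebra.
  rewrite (_ : [set c | _] = \bigcup_(f in [set` r]) tail_cosets M f) //.
  by apply: bigcup_open => *; exact: tail_cosets_open.
rewrite (_ : [set c | _] = tail_cosets M f `|`
    [set c | exists2 f, f \in s & tail_cosets M f c]); last first.
  apply/seteqP; split=> c /=.
    by move=> [g]; rewrite inE => /orP[/eqP->|gs gc]; [left|right; exists g].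
  move=> [fc|[g gs gc]]; first by exists f; rewrite ?inE ?eqxx.
  by exists g; rewrite ?inE ?gs ?orbT.
move: us => /= /andP[fs us].
have dis : tail_cosets M f `&`
    [set c | exists2 f, f \in s & tail_cosets M f c] = set0.
  rewrite -subset0 => c [fc [g gs gc]]; move: fs.
  by rewrite (sI f g c) ?inE ?gs ?eqxx ?orbT.
rewrite (measureU P (tail_cosets_measurable M f) (mU s) dis).
transitivity (P (tail_cosets M 1%g) + (size s)%:R%:E * P (tail_cosets M 1%g)).
  congr (_ + _); first exact: tail_cosets_measure.
  by apply: IHs => // f' g c fs' gs; apply: sI; rewrite inE ?fs' ?gs orbT.
by rewrite -GRing.nat1r EFinD ge0_muleDl ?mul1e //.
Qed.

End measure.

(** Disjoint translates all have the same positive measure, so that their number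
    is bounded. *)
Lemma finite_covolume_level M : finite_covolume R H ->
  exists T : seq zperm, forall g, alt_on (zbelow (Posz (k M))) g ->
    exists2 t, t \in T & level k_inc D (cs_perms H) M (t^-1 * g).
Proof.
move=> [P P_inv]; apply: contrapT => noT.
have long r : exists s : seq G, [/\ uniq s, size s = r,
    (forall f, f \in s -> supported (zbelow (Posz (k M))) (val f)) &
    (forall f g c, f \in s -> g \in s -> tail_cosets M f c ->
      tail_cosets M g c -> f = g)].
  elim: r => [|r [s [us sr sM sI]]]; first by exists [::].
  have [g gM gs] : exists2 g : G, supported (zbelow (Posz (k M))) (val g) &
      forall f, f \in s ->
        ~ level k_inc D (cs_perms H) M ((val f : zperm)^-1 * val g).
    apply: contrapT => nog; apply: noT; exists (map val s) => g gM.
    have gG : g \in alt_prod_set k_inc D.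
      by apply: alt_on_alt_prod; apply: alt_onS gM; exact: subsetT.
    apply: contrapT => not; apply: nog; exists (Sub g gG).
      by rewrite SubK; exact: alt_on_supported.
    move=> f fs Lfg; apply: not; exists (val f); first exact: map_f.
    by move: Lfg; rewrite SubK.
  have gsN : g \notin s.
    apply/negP => /gs; apply; rewrite mulVg.
    by have [] := level_group k_inc D M (cs_perms_group H).
  have gNf f c : f \in s -> tail_cosets M f c -> tail_cosets M g c -> False.
    move=> fs fc gc; apply: (gs f fs).
    by apply: tail_cosets_meet fc gc => //; exact: sM.
  exists (g :: s); split; rewrite /= ?gsN ?us ?sr //.
    by move=> f; rewrite inE => /orP[/eqP->|/sM].
  move=> f f' c; rewrite !inE => /orP[/eqP->|fs] /orP[/eqP->|fs'] //.
  - by move=> gc fc; case: (gNf f' c).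
  - by move=> fc gc; case: (gNf f c).
  - exact: sI.
have p0 := tail_cosets_gt0 P_inv M.
pose p := fine (P (tail_cosets M 1)).
have pE : P (tail_cosets M 1) = p%:E.
  rewrite fineK // fin_num_measure //; exact: tail_cosets_measurable.
have {}p0 : (0 < p)%R by rewrite -lte_fin -pE.
have [s [us sr _ sI]] := long (Num.bound (p^-1)%R).
have := disjoint_tail_cosets P_inv us sI.
rewrite sr pE -EFinM => Ps.
have : (P [set c | exists2 f, f \in s & tail_cosets M f c] <= 1)%E.
  apply: probability_le1; apply: sub_sigma_algebra.
  rewrite (_ : [set c | _] = \bigcup_(f in [set` s]) tail_cosets M f) //.
  by apply: bigcup_open => *; exact: tail_cosets_open.
rewrite Ps lee_fin Order.TotalTheory.leNgt => /negP; apply.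
have pV : (0 <= p^-1)%R by rewrite Num.Theory.invr_ge0 Order.POrderTheory.ltW.
have := Num.Theory.archi_boundP pV.
by rewrite -(Num.Theory.ltr_pM2r p0) GRing.mulVf // Order.POrderTheory.gt_eqF.
Qed.

(** The finitely supported even permutations are dense, and [H] comes as close to
    each of them as the tails allow. *)
Lemma level_full : (forall M, alt_on (zbelow (Posz (k M))) `<=`
  level k_inc D (cs_perms H) M) -> cs_set H = setT.
Proof.
move=> HL; apply/seteqP; split=> // g _; apply: cs_closed => B /nbhsGP[N NB].
have [f [y [fA yN gE]]] := alt_prod_decomp_tail D_alt N (valP g).
have [n fn] := alt_on_zball fA.
have fM : alt_on (zbelow (Posz (k (maxn n N)))) f.
  apply: alt_onS fn => z; rewrite /zball /zbelow /=.
  by have := geq_k k_inc (maxn n N); lia.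
have [_ [t tM [h Hh hE]]] := HL _ _ fM.
exists h; split=> //.
have -> : h = g * inc (prodD_mul (prodD_inv y) t).
  apply: val_inj; rewrite hE valM [X in _ = X * _]gE /= -mulgA -prodD_permM.
  by rewrite prodD_mulVK.
apply: NB; apply: tailDM; first exact: tailDV.
by apply: tailDW tM; exact: leq_maxr.
Qed.

Lemma finite_covolume_full : finite_covolume R H -> cs_set H = setT.
Proof.
move=> covH; apply: level_full => M.
have [T LT] := finite_covolume_level M covH.
exact: (finite_index_alt (level_group k_inc D M (cs_perms_group H)) LT).
Qed.

End finite_covolume.

Theorem theorem5p1 (R : realType) (k : nat -> nat)
    (k0 : k 0%N = 0%N) (k_inc : {homo k : m n / (m < n)%N})
    (D : forall n, {group 'S_(k n.+1 - k n)})
    (D_alt : forall n, D n \subset 'Alt_('I_(k n.+1 - k n))) :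
  no_nontrivial_URS (alt_prod k_inc D) /\
  (forall H : closedSubgroup (alt_prod k_inc D),
     finite_covolume R H -> cs_set H = [set: alt_prod k_inc D]).
Proof.
split=> [|H]; first exact: alt_prod_URS.
exact: finite_covolume_full.
Qed.
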